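(* Let $k\ge1$ be an integer and $m=8+4k$. For real numbers $1\le t_1\le\dots\le t_k$ let $$\mathcal{S}_{t_1,\dots,t_k}=\{(\mathrm{i},2),(\mathrm{i}t_1,1),\dots,(\mathrm{i}t_k,1)\}\qquad(\mathrm{i}=\sqrt{-1}).$$ Then the algebras $\mu_{\mathcal{S}_{t_1,\dots,t_k}}$, $1\le t_1\le\dots\le t_k$, form a $k$-parameter family of pairwise non-isomorphic indecomposable nonsingular $2$-step algebras of type $(2,m)$ which do not admit any nilsoliton metric.
   Context: Let $\mathfrak{n}=\mathfrak{n}_1\oplus\mathfrak{n}_2$ be a real inner product space with $\mathfrak{n}_1\perp\mathfrak{n}_2$ and orthonormal bases $\{X_1,\dots,X_m\}$ of $\mathfrak{n}_1$, $\{Z_1,Z_2\}$ of $\mathfrak{n}_2$. A bilinear skew-symmetric map $\mu:\mathfrak{n}_1\times\mathfrak{n}_1\to\mathfrak{n}_2$ is regarded as a $2$-step nilpotent Lie bracket on $\mathfrak{n}$ (with $\mathfrak{n}_2$ central); it is of type $(2,m)$ if $\mu(\mathfrak{n}_1,\mathfrak{n}_1)=\mathfrak{n}_2$. It is determined by $J_\mu:\mathfrak{n}_2\to\mathfrak{so}(\mathfrak{n}_1)$, $\langle J_\mu(Z)X,Y\rangle=\langle\mu(X,Y),Z\rangle$, and is nonsingular if $J_\mu(Z)$ is invertible for all $Z\ne0$. Isomorphic means isomorphic as Lie algebras; indecomposable means not a direct sum of two nonzero ideals. Definition of $\mu_{\mathcal{S}}$ for a multiset $\mathcal{S}$ of pairs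 $(\alpha,k)$, $\alpha\in\mathbb{C}\smallsetminus\mathbb{R}$, $k\ge1$ an integer: the matrix of $J_{\mu_{\mathcal{S}}}(xZ_1+yZ_2)$ with respect to $\{X_i\}$ is block diagonal with one diagonal block for each element of $\mathcal{S}$. The block attached to $(a+\mathrm{i}b,k)$ ($a,b\in\mathbb{R}$, $b\neq0$) is the $4k\times4k$ matrix $\begin{bmatrix} 0 & A \\ -A^t & 0 \end{bmatrix}$, where $A$ is $2k\times2k$, partitioned into $2\times2$ blocks $A_{ij}$, $1\le i,j\le k$, with $A_{ij}=\begin{bmatrix} -bx & y-ax \\ y-ax & bx \end{bmatrix}$ if $i+j=k+1$, $A_{ij}=\begin{bmatrix} 0 & x \\ x & 0 \end{bmatrix}$ if $i+j=k+2$, and $0$ otherwise. A nilsoliton metric for $(\mathfrak{n},\mu)$ is an inner product on $\mathfrak{n}$ such that the corresponding left-invariant Riemannian metric $g$ on the simply connected nilpotent Lie group with Lie algebra $(\mathfrak{n},\mu)$ is a Ricci soliton, i.e. the Ricci flow solution starting at $g$ evolves only by time-dependent scaling and pull-back by diffeomorphisms; in this setting this is known to be equivalent to: the Ricci operator of $g$ equals $cI+D$ for some $c\in\mathbb{R}$ and some derivation $D$ of $(\mathfrak{n},\mu)$. *)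

(* Defs.v *)
From HB Require Import structures.
From mathcomp Require Import all_boot all_order all_algebra.
From mathcomp Require Import reals.
From mathcomp Require Import complex ring.

Set Implicit Arguments.
Unset Strict Implicit.
Unset Printing Implicit Defensive.

Import Order.TTheory GRing.Theory Num.Theory.

Local Open Scope ring_scope.

Section LieAlgebra.
Variables (R : realType) (V : vectType R).
Implicit Types (br : V -> V -> V) (I : {vspace V}).

Definition is_lie_bracket br : Prop :=
  [/\ bilinear_for *:%R *:%R br,
      forall x, br x x = 0
    & forall x y z, br x (br y z) + br y (br z x) + br z (br x y) = 0].

Definition two_step br : Prop :=
  [/\ is_lie_bracket br,
      exists x y, br x y != 0
    & forall x y z, br (br x y) z = 0].

Definition is_ideal br I : Prop := forall x y, y \in I -> br x y \in I.

Definition indecomposable br : Prop :=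
  ~ exists I1 I2 : {vspace V},
      [/\ is_ideal br I1, is_ideal br I2,
          I1 != 0%VS /\ I2 != 0%VS,
          (I1 + I2)%VS = fullv
        & (I1 :&: I2)%VS = 0%VS].

Definition is_derivation br (D : 'End(V)) : Prop :=
  forall x y, D (br x y) = br (D x) y + br x (D y).

End LieAlgebra.

Definition lie_isomorphic (R : realType) (V W : vectType R)
    (brV : V -> V -> V) (brW : W -> W -> W) : Prop :=
  exists f : 'Hom(V, W),
    bijective f /\ forall x y, f (brV x y) = brW (f x) (f y).

(* Geometry of the left-invariant metric on the simply connected Lie group
   with Lie algebra (V, br) which restricts to g on V, expressed on
   left-invariant vector fields, i.e. on elements of V. *)
Section LeftInvariantMetric.
Variables (R : realType) (V : vectType R).
Variables (br : V -> V -> V) (g : {dot V for idfun}).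

Let e := vbasis {:V}.

Definition gram : 'M[R]_(\dim {:V}) := \matrix_(i, j) g e`_i e`_j.

(* The vector v such that g v z = phi z for all z, when phi is linear. *)
Definition riesz (phi : V -> R) : V :=
  \sum_i (invmx gram *m (\col_j phi e`_j)) i 0 *: e`_i.

Definition endo_trace (f : V -> V) : R := \sum_i coord e i (f e`_i).

(* Levi-Civita connection, by the Koszul formula: the terms differentiating
   inner products vanish, as these are constant on left-invariant fields. *)
Definition nabla (x y : V) : V :=
  riesz (fun z => 2%:R^-1 * (g (br x y) z - g (br y z) x + g (br z x) y)).

Definition curvature (x y z : V) : V :=
  nabla x (nabla y z) - nabla y (nabla x z) - nabla (br x y) z.

Definition ricci (y z : V) : R := endo_trace (fun x => curvature x y z).

Definition ricci_op (y : V) : V := riesz (ricci y).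

(* For a left-invariant metric on a simply connected nilpotent Lie group this
   is equivalent (Lauret) to being a Ricci soliton. *)
Definition is_nilsoliton : Prop :=
  exists (c : R) (D : 'End(V)),
    is_derivation br D /\ forall x, ricci_op x = c *: x + D x.

Lemma metricC x y : g x y = g y x.
Proof. by rewrite hermC expr0 mul1r. Qed.

Lemma gram_unit : gram \in unitmx.
Proof.
rewrite -row_free_unit -kermx_eq0; apply/rowV0P => u /sub_kermxP hu.
pose v := \sum_i u 0 i *: e`_i.
have [v0|v0] := eqVneq v 0.
  apply/rowP => i; rewrite mxE.
  by have /freeP/(_ (fun i => u 0 i) v0 i) -> := basis_free (vbasisP {:V}).
have gv (j : 'I_(\dim {:V})) : g v e`_j = 0.
  have := congr1 (fun M : 'rV_(\dim {:V}) => M 0 j) hu; rewrite !mxE => h.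
  rewrite -[RHS]h /v linear_sumlz; apply: eq_bigr => i _.
  by rewrite linearZl_LR mxE.
have := @neq0_dnorm_gt0 _ _ _ g v v0.
rewrite {2}/v linear_sumr big1 ?ltxx // => j _.
by rewrite linearZr_LR /= gv mulr0.
Qed.

Lemma rieszP (phi : V -> R) z : scalar phi -> g (riesz phi) z = phi z.
Proof.
move=> lphi.
pose phiL := GRing.isLinear.Build R V R *%R phi lphi.
pose phi' : {scalar V} := HB.pack phi phiL.
rewrite (coord_vbasis (memvf z)) -/e -[RHS]/(phi' _) !linear_sumr linear_sum.
apply: eq_bigr => j _; rewrite linearZr_LR linearZ /=; congr (_ * _).
rewrite linear_sumlz.
have <- : (gram *m (invmx gram *m \col_j phi e`_j)) j 0 = phi e`_j.
  by rewrite mulKVmx ?gram_unit // mxE.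
rewrite [RHS]mxE; apply: eq_bigr => i _.
by rewrite linearZl_LR /= metricC mulrC [gram j i]mxE.
Qed.

Section LeviCivita.
Hypothesis hbr : is_lie_bracket br.

Lemma koszul x y z :
  g (nabla x y) z = 2%:R^-1 * (g (br x y) z - g (br y z) x + g (br z x) y).
Proof.
rewrite rieszP // => c u v; have [hb _ _] := hbr.
by rewrite hb.1 hb.2 !linearPr !linearPl /=; ring.
Qed.

Lemma bracketC x y : br x y = - br y x.
Proof.
have [hb alt _] := hbr; apply/eqP; rewrite -addr_eq0; apply/eqP.
have Dr u : br u (x + y) = br u x + br u y.
  by have := hb.2 u 1 x y; rewrite /= !scale1r.
have Dl u : br (x + y) u = br x u + br y u.
  by have := hb.1 u 1 x y; rewrite /= !scale1r.
by have := alt (x + y); rewrite Dl !Dr !alt add0r addr0.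
Qed.

Lemma metric_inj x y : (forall z, g x z = g y z) -> x = y.
Proof.
move=> h; apply/eqP; rewrite -subr_eq0; apply/negPn/negP => n0.
by have := @neq0_dnorm_gt0 _ _ _ g _ n0; rewrite linearBl /= h subrr ltxx.
Qed.

Lemma nabla_torsion_free x y : nabla x y - nabla y x = br x y.
Proof.
apply: metric_inj => z; rewrite linearBl /= !koszul.
by rewrite (bracketC y x) (bracketC x z) (bracketC z y) !linearNl /=; field.
Qed.

Lemma nabla_metric x y z : g (nabla x y) z + g y (nabla x z) = 0.
Proof.
rewrite (metricC y) !koszul (bracketC z x) (bracketC z y) (bracketC y x).
by rewrite !linearNl /=; field.
Qed.

End LeviCivita.

End LeftInvariantMetric.

Definition admits_nilsoliton (R : realType) (V : vectType R)
    (br : V -> V -> V) : Prop :=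
  exists g : {dot V for idfun}, is_nilsoliton br g.

(* A bilinear skew-symmetric mu : n1 x n1 -> n2, with n1 = R^m and n2 = R^n
   carrying their standard orthonormal bases; n1 (+) n2 is 'cV_m * 'cV_n. *)
Section TwoStep.
Variables (R : realType) (m n : nat).
Implicit Types (mu : 'cV[R]_m -> 'cV[R]_m -> 'cV[R]_n).

Definition inner d (u v : 'cV[R]_d) : R := (u^T *m v) 0 0.

Definition lie_of mu (u v : 'cV[R]_m * 'cV[R]_n) : 'cV[R]_m * 'cV[R]_n :=
  (0, mu u.1 v.1).

(* mu(n1, n1) = n2 is understood as: the values of mu span n2. *)
Definition of_type (p q : nat) mu : Prop :=
  [/\ n = p /\ m = q, bilinear_for *:%R *:%R mu,
      forall X Y, mu X Y = - mu Y X
    & forall W : {vspace 'cV[R]_n},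
        (forall X Y, mu X Y \in W) -> W = fullv].

(* Matrices of operators have the coordinates of the images of the basis
   vectors as columns, so entry (i, j) is <J_mu(Z) X_j, X_i>. *)
Definition Jmx mu (Z : 'cV[R]_n) : 'M[R]_m :=
  \matrix_(i, j) inner (mu (delta_mx j 0) (delta_mx i 0)) Z.

Definition nonsingular mu : Prop := forall Z, Z != 0 -> Jmx mu Z \in unitmx.

End TwoStep.

Section Pencil.
Variable R : realType.
Implicit Types (x y : R) (al : R[i]) (S : seq (R[i] * nat)).

Definition mx22 (a b c d : R) : 'M[R]_2 :=
  \matrix_(i, j) if i == 0 then (if j == 0 then a else b)
                 else (if j == 0 then c else d).

(* Block indices start at 0: the conditions i + j = k + 1 and i + j = k + 2
   on indices starting at 1 become i + j + 1 = k and i + j = k. *)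
Definition Amx al (k : nat) x y : 'M[R]_(\sum_(i < k) 2, \sum_(j < k) 2) :=
  let a := complex.Re al in let b := complex.Im al in
  \mxblock_(i < k, j < k)
    (if (i + j).+1 == k
     then mx22 (- b * x) (y - a * x) (y - a * x) (b * x)
     else if (i + j)%N == k then mx22 0 x x 0 else 0).

Definition Sblock al (k : nat) x y :
    'M[R]_(\sum_(i < k) 2 + \sum_(j < k) 2) :=
  block_mx 0 (Amx al k x y) (- (Amx al k x y)^T) 0.

Definition bdim S (l : 'I_(size S)) : nat :=
  let k := (tnth (in_tuple S) l).2 in (\sum_(i < k) 2 + \sum_(j < k) 2)%N.

Definition Sdim S : nat := (\sum_(l < size S) bdim l)%N.

(* A multiset of pairs is given by a list; reordering the list only permutes
   the diagonal blocks. *)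
Definition Spencil S x y : 'M[R]_(Sdim S) :=
  \mxdiag_(l < size S)
    (Sblock (tnth (in_tuple S) l).1 (tnth (in_tuple S) l).2 x y
       : 'M[R]_(bdim l)).

(* The coordinate of mu_S X Y along Z_l is <J(Z_l) X, Y>. *)
Definition mu_of S (X Y : 'cV[R]_(Sdim S)) : 'cV[R]_2 :=
  \col_(l < 2) inner (Spencil S (l == 0)%:R (l == 1)%:R *m X) Y.

Lemma mxblock_lin (p q : nat) (p_ : 'I_p -> nat) (q_ : 'I_q -> nat)
    (B C : forall i j, 'M[R]_(p_ i, q_ j)) x y :
  x *: (\mxblock_(i < p, j < q) B i j) + y *: (\mxblock_(i < p, j < q) C i j) =
  \mxblock_(i < p, j < q) (x *: B i j + y *: C i j).
Proof. by apply/matrixP => r c; rewrite !mxE. Qed.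

Lemma Amx_lin al k x y : Amx al k x y = x *: Amx al k 1 0 + y *: Amx al k 0 1.
Proof.
rewrite mxblock_lin; apply: eq_mxblock => i j.
case: ifP => _; last case: ifP => _; last by rewrite !scaler0 addr0.
  by apply/matrixP => r c; rewrite !mxE; do 2!case: ifP => _; ring.
by apply/matrixP => r c; rewrite !mxE; do 2!case: ifP => _; ring.
Qed.

Lemma Sblock_lin al k x y :
  Sblock al k x y = x *: Sblock al k 1 0 + y *: Sblock al k 0 1.
Proof.
rewrite /Sblock Amx_lin !scale_block_mx add_block_mx !scaler0 !addr0.
by rewrite linearD !linearZ /= opprD !scalerN.
Qed.

Lemma Spencil_lin S x y :
  Spencil S x y = x *: Spencil S 1 0 + y *: Spencil S 0 1.
Proof.
rewrite /Spencil mxblock_lin; apply: eq_mxblock => i j.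
case: eqVneq => [<-|_]; last by rewrite !scaler0 addr0.
by rewrite !conform_mx_id Sblock_lin.
Qed.

Lemma Jmx_mu_of S (Z : 'cV[R]_2) :
  Jmx (@mu_of S) Z = Spencil S (Z 0 0) (Z 1 0).
Proof.
have ent l (i j : 'I_(Sdim S)) :
    mu_of (delta_mx j 0) (delta_mx i 0) l 0
    = Spencil S (l == 0)%:R (l == 1)%:R i j.
  by rewrite mxE /inner -!colE !mxE.
have lin (A B : 'M[R]_(Sdim S)) (a b : R) i j :
    (a *: A + b *: B) i j = A i j * a + B i j * b.
  by rewrite !mxE !(mulrC a, mulrC b).
have dot (u : 'cV[R]_2) : inner u Z = u 0 0 * Z 0 0 + u 1 0 * Z 1 0.
  rewrite /inner mxE big_ord_recl big_ord1 !mxE.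
  by rewrite (_ : lift ord0 ord0 = 1) //; apply: val_inj.
by apply/matrixP => i j; rewrite Spencil_lin lin mxE dot !ent /=.
Qed.

Definition S_fam (t : seq R) : seq (R[i] * nat) :=
  (('i)%C, 2%N) :: [seq ((('i)%C * (s%:C)%C), 1%N) | s <- t].

End Pencil.

Arguments mu_of {R} S X Y.

(* Main.v *)
(* No nilsoliton. A nilsoliton has Ric = c + D. Taking traces of the derivation
   identity against a nonsingular J(z), z an eigenvector of D in the 2-dimensional
   center Z, shows that D is a scalar on Z; then D minus half of that scalar
   anticommutes with every J(z) on the complement of Z, is trace-orthogonal to Ric
   and so vanishes: Ric is a scalar on the complement of Z. Hence, if
   Z <= L <= M, [L, M] = 0 and dim L + dim M = dim V + dim Z, comparing the Ricci
   traces of L / Z and V / M gives [M^perp, L^perp] = 0. For the block (i, 2), with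
   T = J2 J1 and N the nilpotent part T^2 + 1 of T on that block, L = im N + Z
   and M = ker N + Z form such a flag, but M^perp cannot have this property.

   Non-isomorphism. An isomorphism is a congruence of pencils a J1 + b J2 up to a
   linear change k of (a, b). Over the complex numbers, the Jordan chain of the
   block (i, 2) forces k to preserve the isotropic points a^2 + b^2 = 0, so k is
   conformal; then the coranks at the points (1, i tau), tau > 1, count the
   parameters equal to tau. *)

Require Import Defs.
From HB Require Import structures.
From mathcomp Require Import all_boot all_order all_algebra.
From mathcomp Require Import reals.
From mathcomp Require Import complex ring lra zify.

Set Implicit Arguments.
Unset Strict Implicit.
Unset Printing Implicit Defensive.

Import Order.TTheory GRing.Theory Num.Theory.

Local Open Scope ring_scope.

(** Since [J2 *m J2 = - 1%:M], one has J1 = - J2 T and a J1 + b J2 = J2 (b - a T), so the pencil is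
    governed by the Jordan form of the single operator T. On the block (i t, 1) one has T^2 = - t^2;
    only the block (i, 2) carries a nontrivial Jordan block, at the eigenvalues i and -i. Both J1
    and J2 intertwine N with its transpose, which is why im N and ker N commute. The metric g is
    arbitrary: it need not make the two factors orthogonal, nor be related to the inner product that
    defines J. Hence L and M are built from the bracket alone, and g enters only through their
    orthogonals. For non-isomorphism, complex points are needed because the pencil has full rank at
    every nonzero real point. A change k acts on the eigenvalues of T as a real Moebius map. The
    double block pins the pair i, -i, and what remains can send i t, t > 1, back to the imaginary
    axis only at i t or i / t, up to sign; the normalisation t >= 1 excludes i / t. Parameters equal
    to 1 share their eigenvalues with the double block, so they are not counted by ranks but
    recovered from the length k. *)

(** * Orthonormal families, orthogonal complements and traces *)

Section OrthonormalSequences.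
Variables (R : realType) (V : vectType R) (g : {dot V for idfun}).
Implicit Types (X Y : seq V) (U W : {vspace V}).

(** Lists rather than indexed families, so that a basis adapted to a flag is a concatenation and
    sums over it split with [big_cat]. *)
Fixpoint orthonormal_seq X : Prop :=
  if X is x :: Y then
    [/\ g x x = 1, {in Y, forall y, g x y = 0} & orthonormal_seq Y]
  else True.

Lemma metric_eq0 x : g x x = 0 -> x = 0.
Proof.
by move=> h; apply/eqP/negPn/negP => /(@neq0_dnorm_gt0 _ _ _ g); rewrite h ltxx.
Qed.

Lemma metric_ge0 x : 0 <= g x x.
Proof.
have [->|x0] := eqVneq x 0; first by rewrite linear0l.
by rewrite ltW // (@neq0_dnorm_gt0 _ _ _ g).
Qed.

Lemma capv_orthov U : (U :&: orthov g U)%VS = 0%VS.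
Proof.
apply/eqP; rewrite -subv0; apply/subvP => x /memv_capP[xU /mem_orthovP h].
by rewrite memv0; apply/eqP/metric_eq0/h.
Qed.

Lemma orthonormal_seq_cat X Y : orthonormal_seq X -> orthonormal_seq Y ->
  {in X & Y, forall x y, g x y = 0} -> orthonormal_seq (X ++ Y).
Proof.
elim: X => //= x X IH [gx xX oX] oY XY; split=> //; last first.
  by apply: IH => // u v uX; apply: XY; rewrite inE uX orbT.
move=> y; rewrite mem_cat => /orP[/xX //|]; apply: XY; exact: mem_head.
Qed.

Lemma orthonormal_expand X v : orthonormal_seq X -> v \in <<X>>%VS ->
  v = \sum_(x <- X) g v x *: x.
Proof.
elim: X v => [|x X IH] v /=.
  by rewrite span_nil memv0 big_nil => _ /eqP.
case=> gx xX oX; rewrite span_cons => /memv_addP[_ /vlineP[c ->]] [w wX ->].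
have gxw : g x w = 0.
  by rewrite (IH _ oX wX) linear_sumr big_seq big1 // => y /xX h;
     rewrite linearZr_LR /= h mulr0.
rewrite big_cons linearDl /= linearZl_LR /= gx mulr1 (metricC g w) gxw addr0.
congr (_ + _); rewrite {1}(IH _ oX wX) !big_seq; apply: eq_bigr => y yX.
by rewrite linearDl /= linearZl_LR /= xX // mulr0 add0r.
Qed.

Lemma parseval X u v : orthonormal_seq X -> v \in <<X>>%VS ->
  g u v = \sum_(x <- X) g u x * g v x.
Proof.
move=> oX vX; rewrite {1}(orthonormal_expand oX vX) linear_sumr.
by apply: eq_bigr => x _; rewrite linearZr_LR /= mulrC.
Qed.

Lemma orthonormal_free X : orthonormal_seq X -> free X.
Proof.
elim: X => [|x X IH] /=; first by rewrite nil_free.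
case=> gx xX oX; rewrite free_cons IH // andbT; apply/negP => xs.
have := gx; rewrite (parseval x oX xs) big_seq big1.
  by move/esym/eqP; rewrite oner_eq0.
by move=> y /xX ->; rewrite mulr0.
Qed.

Lemma dim_orthonormal X : orthonormal_seq X -> \dim <<X>> = size X.
Proof. by move/orthonormal_free/eqP. Qed.

(** Gram-Schmidt by induction on the dimension: normalise a nonzero vector of [U] and recurse on its
    orthogonal complement inside [U]. *)
Lemma orthonormal_basis_exists U :
  exists2 X, orthonormal_seq X & <<X>>%VS = U.
Proof.
elim: {U}(\dim U) {-2}U (erefl (\dim U)) => [|n IH] U dU.
  exists [::] => //; rewrite span_nil; apply/esym/eqP.
  by rewrite -dimv_eq0 dU.
have U0 : U != 0%VS by rewrite -dimv_eq0 dU.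
pose u := vpick U; have u0 : u != 0 by rewrite vpick0.
have uU : u \in U by exact: memv_pick.
have gu : 0 < g u u := @neq0_dnorm_gt0 _ _ _ g _ u0.
pose x := (Num.sqrt (g u u))^-1 *: u.
have gx : g x x = 1.
  rewrite linearZl_LR /= linearZr_LR /= mulrA -invfM -expr2 sqr_sqrtr ?ltW //.
  by rewrite mulVf // gt_eqF.
have xU : x \in U by rewrite memvZ.
have sU : (<[x]> + (U :&: orthov g <[x]>))%VS = U.
  apply/eqP; rewrite eqEsubv subv_add -memvE xU capvSl /=.
  apply/subvP => v vU; rewrite -(subrK (g v x *: x) v) addrC.
  apply: memv_add; first by rewrite memvZ ?memv_line.
  rewrite memv_cap rpredB ?rpredZ //=; apply/mem_orthovP => _ /vlineP[c ->].
  by rewrite linearZr_LR /= linearBl /= linearZl_LR /= gx mulr1 subrr mulr0.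
have dW : \dim (U :&: orthov g <[x]>) = n.
  have := dimv_disjoint_sum (U := <[x]>%VS) (V := (U :&: orthov g <[x]>)%VS).
  rewrite sU dU dim_vline.
  have -> : x != 0.
    by apply/eqP => x0; move: gx; rewrite x0 linear0l => /esym/eqP;
       rewrite oner_eq0.
  rewrite capvA (capvC _ U) -capvA capv_orthov capv0 => /(_ erefl).
  by rewrite add1n => -[].
have [X oX sX] := IH _ dW; exists (x :: X); last by rewrite span_cons sX sU.
split=> // y yX; have : y \in <<X>>%VS by exact: memv_span.
by rewrite sX memv_cap => /andP[_ /mem_orthovP/(_ x (memv_line x))]; rewrite metricC.
Qed.

Lemma addv_orthov U W : (W <= U)%VS -> (W + (U :&: orthov g W))%VS = U.
Proof.
move=> WU; have [X oX sX] := orthonormal_basis_exists W.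
apply/eqP; rewrite eqEsubv subv_add WU capvSl /=.
apply/subvP => v vU; pose w := \sum_(x <- X) g v x *: x.
have wW : w \in W.
  rewrite /w big_seq; apply: rpred_sum => x xX.
  by rewrite memvZ // -sX memv_span.
rewrite -(subrK w v) addrC memv_add // memv_cap rpredB ?(subvP WU _ wW) //=.
apply/mem_orthovP => y; rewrite -sX => yX; rewrite linearBl /= (parseval v oX yX).
rewrite /w linear_sumlz.
apply/eqP; rewrite subr_eq0; apply/eqP; apply: eq_bigr => x _.
by rewrite linearZl_LR /= (metricC g y).
Qed.

Lemma dim_orthov U W : (W <= U)%VS ->
  \dim U = (\dim W + \dim (U :&: orthov g W))%N.
Proof.
move=> WU; rewrite -[in LHS](addv_orthov WU) dimv_disjoint_sum //.
by rewrite capvA (capvC _ U) -capvA capv_orthov capv0.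
Qed.

(** Basis independence of the trace: expanding [f x] in the reference basis, and each reference
    vector in [X], produces the same double sum. *)
Lemma endo_trace_orthonormal (f : {linear V -> V}) X :
  orthonormal_seq X -> <<X>>%VS = fullv ->
  endo_trace f = \sum_(x <- X) g (f x) x.
Proof.
move=> oX sX; rewrite /endo_trace.
have step x : g (f x) x = \sum_i coord (vbasis {:V}) i (f x) * g (vbasis {:V})`_i x.
  rewrite {1}(coord_vbasis (memvf (f x))) linear_sumlz.
  by apply: eq_bigr => i _; rewrite linearZl_LR.
under [RHS]eq_bigr do rewrite step.
rewrite exchange_big; apply: eq_bigr => i _ /=.
have eX : (vbasis {:V})`_i \in <<X>>%VS by rewrite sX memvf.
rewrite {1}(orthonormal_expand oX eX) !linear_sum.
by apply: eq_bigr => x _; rewrite !linearZ /= mulrC.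
Qed.

End OrthonormalSequences.

(** * The Ricci tensor of a 2-step nilpotent metric Lie algebra *)

Section TwoStepRicci.
Variables (R : realType) (V : vectType R) (br : V -> V -> V).
Variables (g : {dot V for idfun}) (Z : {vspace V}).
Hypothesis hbr : is_lie_bracket br.
Hypothesis brZ : forall x y, br x y \in Z.
Hypothesis Zcentral : forall z x, z \in Z -> br z x = 0.

Lemma bracketPl c u v y : br (c *: u + v) y = c *: br u y + br v y.
Proof. by have [hb _ _] := hbr; rewrite hb.1. Qed.

Lemma bracketPr c u v y : br y (c *: u + v) = c *: br y u + br y v.
Proof. by have [hb _ _] := hbr; rewrite hb.2. Qed.

Lemma bracket_suml I r (P : pred I) (F : I -> V) y :
  br (\sum_(i <- r | P i) F i) y = \sum_(i <- r | P i) br (F i) y.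
Proof.
pose bL := GRing.isLinear.Build R V V *:%R (br^~ y)
  (fun c u v => bracketPl c u v y).
pose b : {linear V -> V} := HB.pack (br^~ y) bL.
exact: (linear_sum b).
Qed.

Lemma bracketZl c x y : br (c *: x) y = c *: br x y.
Proof.
have := bracketPl c x 0 y; rewrite addr0 => ->.
by have := bracketPl (-1) 0 0 y; rewrite scaler0 addr0 scaleN1r addNr => ->; rewrite addr0.
Qed.

Lemma bracketZr c x y : br x (c *: y) = c *: br x y.
Proof. by rewrite (bracketC hbr) bracketZl -scalerN -(bracketC hbr). Qed.

Lemma bracket_sumr I r (P : pred I) (F : I -> V) y :
  br y (\sum_(i <- r | P i) F i) = \sum_(i <- r | P i) br y (F i).
Proof.
rewrite (bracketC hbr) bracket_suml -sumrN; apply: eq_bigr => i _.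
by rewrite -(bracketC hbr).
Qed.

Lemma bracket_centralr z x : z \in Z -> br x z = 0.
Proof. by move=> zZ; rewrite (bracketC hbr) Zcentral // oppr0. Qed.

Lemma nablaPl c u v y : nabla br g (c *: u + v) y =
  c *: nabla br g u y + nabla br g v y.
Proof.
apply: (@metric_inj _ _ g) => z; rewrite linearPl /= !koszul // bracketPl.
by rewrite bracketPr !linearPl linearPr /=; ring.
Qed.

Lemma nablaPr c u v y : nabla br g y (c *: u + v) =
  c *: nabla br g y u + nabla br g y v.
Proof.
apply: (@metric_inj _ _ g) => z; rewrite linearPl /= !koszul // bracketPl.
by rewrite bracketPr !linearPl linearPr /=; ring.
Qed.

Lemma nabla0l y : nabla br g 0 y = 0.
Proof. by have := nablaPl (-1) 0 0 y; rewrite scaler0 addr0 scaleN1r addNr. Qed.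

Lemma curvature_linear1 y z : linear (fun x => curvature br g x y z).
Proof.
move=> c u v; rewrite /curvature !(nablaPl, bracketPl, nablaPr).
rewrite !opprD (addrACA (_ *: nabla br g u _)).
by rewrite [LHS]addrACA !scalerBr.
Qed.

Lemma curvature_linear3 x y c u v : curvature br g x y (c *: u + v) =
  c *: curvature br g x y u + curvature br g x y v.
Proof.
by rewrite /curvature !nablaPr !opprD (addrACA (_ *: nabla br g x _)) [LHS]addrACA !scalerBr.
Qed.

Lemma ricci_linear y : scalar (ricci br g y).
Proof.
move=> c u v; rewrite /ricci /endo_trace mulr_sumr -big_split; apply: eq_bigr.
by move=> i _; rewrite curvature_linear3 linearP.
Qed.

Lemma ricci_opE y z : g (ricci_op br g y) z = ricci br g y z.
Proof. exact: rieszP (ricci_linear y). Qed.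

Lemma nabla_perp a b : a \in orthov g Z -> b \in orthov g Z ->
  nabla br g a b = 2%:R^-1 *: br a b.
Proof.
move=> /mem_orthovP aZ /mem_orthovP bZ; apply: (@metric_inj _ _ g) => w.
rewrite koszul // linearZl_LR /=.
have -> : g (br b w) a = 0 by rewrite metricC aZ.
have -> : g (br w a) b = 0 by rewrite metricC bZ.
by rewrite subr0 addr0.
Qed.

Lemma g_nabla_centerr z a w : z \in Z ->
  g (nabla br g a z) w = - (2%:R^-1 * g (br a w) z).
Proof.
move=> zZ; rewrite koszul // (bracket_centralr _ zZ) (Zcentral _ zZ) !linear0l.
by rewrite (bracketC hbr w) linearNl /=; ring.
Qed.

Lemma g_nabla_centerl z a w : z \in Z ->
  g (nabla br g z a) w = - (2%:R^-1 * g (br a w) z).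
Proof.
move=> zZ; rewrite koszul // (bracket_centralr _ zZ) (Zcentral _ zZ) !linear0l.
by ring.
Qed.

Lemma nabla_center y z : y \in Z -> z \in Z -> nabla br g y z = 0.
Proof.
move=> yZ zZ; apply: (@metric_inj _ _ g) => w.
by rewrite g_nabla_centerr // Zcentral // !linear0l mulr0 oppr0.
Qed.

Variables (XZ XV : seq V).
Hypothesis oZ : orthonormal_seq g XZ.
Hypothesis oV : orthonormal_seq g XV.
Hypothesis sZ : <<XZ>>%VS = Z.
Hypothesis sV : <<XV>>%VS = orthov g Z.

Let X := XZ ++ XV.

Let inZ x : x \in XZ -> x \in Z.
Proof. by move=> xX; rewrite -sZ memv_span. Qed.

Let inV x : x \in XV -> x \in orthov g Z.
Proof. by move=> xX; rewrite -sV memv_span. Qed.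

Lemma orthonormal_split : orthonormal_seq g X.
Proof.
apply: orthonormal_seq_cat => // x y /inZ xZ /inV /mem_orthovP yZ.
by rewrite metricC yZ.
Qed.

Lemma span_split : <<X>>%VS = fullv.
Proof.
rewrite span_cat sZ sV -[orthov g Z]capfv; apply: addv_orthov; exact: subvf.
Qed.

Lemma parseval_split u v : g u v = \sum_(x <- X) g u x * g v x.
Proof.
apply: parseval; first exact: orthonormal_split.
by rewrite span_split memvf.
Qed.

Lemma nabla_diag x : x \in X -> nabla br g x x = 0.
Proof.
have [hb alt _] := hbr.
rewrite mem_cat => /orP[/inZ xZ|/inV xV]; first exact: nabla_center.
by rewrite nabla_perp // alt scaler0.
Qed.

(** Metric compatibility moves the outer derivative onto the basis vector [e]. The term with
    [nabla br g y z] then meets [nabla br g e e], which vanishes in a basis adapted to Z and its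
    complement. *)
Lemma ricci_sum y z : ricci br g y z = \sum_(e <- X)
  (g (nabla br g e z) (nabla br g y e) - g (nabla br g (br e y) z) e).
Proof.
pose fL := GRing.isLinear.Build R V V *:%R _ (curvature_linear1 y z).
pose f : {linear V -> V} := HB.pack (fun x => curvature br g x y z) fL.
rewrite /ricci -/(f : V -> V) (endo_trace_orthonormal f orthonormal_split span_split).
rewrite !big_seq; apply: eq_bigr => e eX.
rewrite /f /= /curvature !linearBl /=; congr (_ - _).
have /eqP := nabla_metric g hbr e (nabla br g y z) e.
rewrite addrC nabla_diag // linear0r add0r => /eqP ->.
have /eqP := nabla_metric g hbr y (nabla br g e z) e.
by rewrite addr_eq0 => /eqP ->; rewrite sub0r opprK.
Qed.

Lemma ricci_perp y z : y \in orthov g Z -> z \in orthov g Z ->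
  ricci br g y z = - (2%:R^-1 * \sum_(f <- XV) g (br y f) (br z f)).
Proof.
move=> yV zV; rewrite ricci_sum big_cat /=.
have -> : \sum_(e <- XZ) (g (nabla br g e z) (nabla br g y e)
      - g (nabla br g (br e y) z) e) =
    4%:R^-1 * \sum_(f <- XV) g (br y f) (br z f).
  transitivity (\sum_(e <- XZ) \sum_(f <- XV)
      4%:R^-1 * (g (br y f) e * g (br z f) e)).
    rewrite !big_seq; apply: eq_bigr => e /inZ eZ.
    rewrite Zcentral // nabla0l linear0l subr0 parseval_split big_cat /=.
    rewrite big_seq big1 ?add0r.
      apply: eq_bigr => f _; rewrite g_nabla_centerl // g_nabla_centerr //.
      by field.
    move=> f /inZ fZ; rewrite g_nabla_centerl // bracket_centralr // linear0l.
    by rewrite mulr0 oppr0 mul0r.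
  rewrite exchange_big mulr_sumr; apply: eq_bigr => f _.
  by rewrite -mulr_sumr (parseval _ oZ) // sZ.
(* Directions of the complement contribute -1/4 from the product of two covariant derivatives and
   -1/2 from the derivative along [br e y]. With the 1/4 from the central directions the total is
   -1/2. *)
rewrite [X in _ + X](_ : _ = - (3%:R / 4%:R *
   \sum_(f <- XV) g (br y f) (br z f))); first by field.
rewrite mulr_sumr -sumrN !big_seq; apply: eq_bigr => e /inV eV.
rewrite (nabla_perp eV zV) (nabla_perp yV eV) g_nabla_centerl // linearZl_LR /= linearZr_LR /=.
rewrite (bracketC hbr e z) (bracketC hbr e y) linearNl linearNr /=.
by rewrite (metricC g (br y e)); field.
Qed.

Lemma ricci_center y z : y \in Z -> z \in Z -> ricci br g y z =
  4%:R^-1 * \sum_(e <- XV) \sum_(f <- XV) g (br e f) y * g (br e f) z.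
Proof.
move=> yZ zZ; rewrite ricci_sum big_cat /= big_seq big1 ?add0r.
  rewrite mulr_sumr !big_seq; apply: eq_bigr => e _.
  rewrite bracket_centralr // nabla0l linear0l subr0 parseval_split big_cat /=.
  rewrite mulr_sumr big_seq big1 ?add0r.
    apply: eq_bigr => f _; rewrite (g_nabla_centerr _ _ zZ) (g_nabla_centerl _ _ yZ).
    by field.
  move=> f /inZ fZ; rewrite g_nabla_centerr // bracket_centralr // linear0l.
  by rewrite mulr0 oppr0 mul0r.
move=> e /inZ eZ; rewrite bracket_centralr // nabla0l linear0l subr0.
by rewrite nabla_center // linear0l.
Qed.

Lemma ricci_center_perp y z : y \in Z -> z \in orthov g Z -> ricci br g y z = 0.
Proof.
move=> yZ zV; rewrite ricci_sum big_seq big1 // => e.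
rewrite bracket_centralr // nabla0l linear0l subr0 mem_cat.
case/orP=> [/inZ eZ|/inV eV]; first by rewrite (nabla_center yZ eZ) linear0r.
rewrite nabla_perp // linearZl_LR /= metricC g_nabla_centerl //.
by rewrite bracket_centralr // linear0l mulr0 oppr0 mulr0.
Qed.

Lemma ricci_perp_center y z : y \in orthov g Z -> z \in Z -> ricci br g y z = 0.
Proof.
move=> yV zZ; rewrite ricci_sum big_seq big1 // => e.
rewrite (@nabla_center (br e y)) // linear0l subr0 mem_cat.
case/orP=> [/inZ eZ|/inV eV]; first by rewrite nabla_center // linear0l.
rewrite (nabla_perp yV) // linearZr_LR /= g_nabla_centerr //.
by rewrite bracket_centralr // linear0l mulr0 oppr0 mulr0.
Qed.

End TwoStepRicci.

(** * Nilsolitons: the Ricci operator is a scalar on the complement of the center *)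

Section NilsolitonPerp.
Variables (R : realType) (V : vectType R) (br : V -> V -> V).
Variables (g : {dot V for idfun}) (Z : {vspace V}).
Hypothesis hbr : is_lie_bracket br.
Hypothesis brZ : forall x y, br x y \in Z.
Hypothesis Zcentral : forall z x, z \in Z -> br z x = 0.
Hypothesis dimZ : \dim Z = 2%N.
(** Injectivity of the operator J(z) attached to [g], phrased through the bracket so that it can be
    checked for every metric at once. *)
Hypothesis nondegenerate : forall z x, z \in Z -> z != 0 ->
  x \in orthov g Z -> (forall y, g (br x y) z = 0) -> x = 0.

Variables (c : R) (D : 'End(V)).
Hypothesis derD : is_derivation br D.
Hypothesis solD : forall x, ricci_op br g x = c *: x + D x.

Variables (XZ XV : seq V).
Hypothesis oZ : orthonormal_seq g XZ.
Hypothesis oV : orthonormal_seq g XV.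
Hypothesis sZ : <<XZ>>%VS = Z.
Hypothesis sV : <<XV>>%VS = orthov g Z.

Let inV x : x \in XV -> x \in orthov g Z.
Proof. by move=> xX; rewrite -sV memv_span. Qed.

Lemma soliton_ricci x y : ricci br g x y = c * g x y + g (D x) y.
Proof. by rewrite -(ricci_opE g hbr) solD linearDl /= linearZl_LR. Qed.

Lemma soliton_center_perp z x : z \in Z -> x \in orthov g Z -> g (D z) x = 0.
Proof.
move=> zZ xV; have := soliton_ricci z x.
rewrite (ricci_center_perp hbr brZ Zcentral oZ oV sZ sV) // metricC.
by move/mem_orthovP: xV => ->//; rewrite mulr0 add0r.
Qed.

Lemma soliton_perp_center x z : x \in orthov g Z -> z \in Z -> g (D x) z = 0.
Proof.
move=> xV zZ; have := soliton_ricci x z.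
rewrite (ricci_perp_center hbr brZ Zcentral oZ oV sZ sV) //.
by move/mem_orthovP: xV => ->//; rewrite mulr0 add0r.
Qed.

Lemma soliton_perp x : x \in orthov g Z -> D x \in orthov g Z.
Proof.
by move=> xV; apply/mem_orthovP => z zZ; exact: soliton_perp_center.
Qed.

Lemma soliton_center z : z \in Z -> D z \in Z.
Proof.
move=> zZ; have : D z \in <<XZ ++ XV>>%VS by rewrite (span_split sZ sV) memvf.
move/(orthonormal_expand (orthonormal_split oZ oV sZ sV)); rewrite big_cat /=.
rewrite [X in _ + X]big_seq [X in _ + X]big1 ?addr0 => [->|x /inV xV].
  by rewrite big_seq; apply: rpred_sum => x xX; rewrite memvZ // -sZ memv_span.
by rewrite soliton_center_perp // scale0r.
Qed.

Lemma soliton_center_sym y z : y \in Z -> z \in Z -> g (D y) z = g y (D z).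
Proof.
move=> yZ zZ; apply: (@addrI _ (c * g y z)).
rewrite -soliton_ricci (metricC g y (D z)) [in RHS]metricC -soliton_ricci.
rewrite !(ricci_center hbr brZ Zcentral oZ oV sZ sV) //; congr (_ * _).
by apply: eq_bigr => e _; apply: eq_bigr => f _; rewrite mulrC.
Qed.

(** Let W be the matrix of the form g([x, y], z) and M the matrix of [D], with images as rows. As
    [D] is symmetric on Z, pairing the derivation identity with the eigenvector [z] gives M W + W
    M^T = la W. W is invertible; multiplying by its inverse and taking traces gives 2 tr M = la
    n. *)
Lemma soliton_trace_eigen z (la : R) : z \in Z -> z != 0 -> D z = la *: z ->
  2%:R * (\sum_(x <- XV) g (D x) x) = la * (size XV)%:R.
Proof.
move=> zZ z0 Dz; pose n := size XV.
pose W : 'M[R]_n := \matrix_(i, j) g (br XV`_i XV`_j) z.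
pose M : 'M[R]_n := \matrix_(i, j) g (D XV`_i) XV`_j.
have xV (i : 'I_n) : XV`_i \in orthov g Z by apply: inV; exact: mem_nth.
have DX (i : 'I_n) : D XV`_i = \sum_(j < n) M i j *: XV`_j.
  have DV : D XV`_i \in <<XV>>%VS by rewrite sV soliton_perp.
  rewrite {1}(orthonormal_expand oV DV) (big_nth 0) big_mkord.
  by apply: eq_bigr => j _; rewrite mxE.
have WA (i j : 'I_n) : W i j = - W j i.
  by rewrite !mxE (bracketC hbr) linearNl.
have MW (i j : 'I_n) : (M *m W) i j = g (br (D XV`_i) XV`_j) z.
  rewrite mxE DX (bracket_suml hbr) linear_sumlz; apply: eq_bigr => k _.
  by rewrite (bracketZl hbr) linearZl_LR /= [W k j]mxE.
have rel : M *m W + W *m M^T = la *: W.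
  have -> : W *m M^T = - (M *m W)^T.
    rewrite trmx_mul -mulNmx; congr (_ *m _).
    by apply/matrixP => i j; rewrite WA [in RHS]mxE [in RHS]mxE.
  apply/matrixP => i j; rewrite [in LHS]mxE [in X in _ + X]mxE [in X in _ - X]mxE.
  rewrite !MW [in RHS]mxE [W i j]mxE (bracketC hbr (D XV`_j)) linearNl /= opprK.
  by rewrite -linearDl /= -derD soliton_center_sym // Dz linearZr_LR.
have Wu : W \in unitmx.
  rewrite -row_free_unit -kermx_eq0; apply/rowV0P => u /sub_kermxP hu.
  pose x := \sum_(i < n) u 0 i *: XV`_i.
  have xX : x \in orthov g Z by apply: rpred_sum => i _; rewrite rpredZ // xV.
  have bx y : br x y = \sum_(i < n) u 0 i *: br XV`_i y.
    by rewrite (bracket_suml hbr); apply: eq_bigr => i _; rewrite (bracketZl hbr).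
  have bxV y : y \in XV -> g (br x y) z = 0.
    move=> yX; have iy : (index y XV < n)%N by rewrite index_mem.
    have := congr1 (fun A : 'rV_n => A 0 (Ordinal iy)) hu; rewrite !mxE => <-.
    rewrite bx linear_sumlz; apply: eq_bigr => i _.
    by rewrite linearZl_LR !mxE /= nth_index.
  have x0 : x = 0.
    apply: (nondegenerate zZ z0 xX) => y.
    have yX : y \in <<XZ ++ XV>>%VS by rewrite (span_split sZ sV) memvf.
    rewrite (orthonormal_expand (orthonormal_split oZ oV sZ sV) yX).
    rewrite (bracket_sumr hbr) linear_sumlz big_seq big1 // => e.
    rewrite (bracketZr hbr) linearZl_LR /= mem_cat => /orP[eX|/bxV->]; last first.
      by rewrite mulr0.
    by rewrite (bracket_centralr hbr Zcentral) ?linear0l ?mulr0 // -sZ memv_span.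
  apply/rowP => i; rewrite mxE.
  have /(@freeP _ _ _ (in_tuple XV)) := orthonormal_free oV.
  by move/(_ (fun i => u 0 i) x0 i).
have : \tr (M + W *m M^T *m invmx W) = \tr (la%:M : 'M[R]_n).
  congr (\tr _); rewrite -[LHS](mulmxK Wu) mulmxDl mulmxKV // rel.
  by rewrite -scalemxAl mulmxV // scalemx1.
rewrite mxtrace_scalar linearD /= mxtrace_mulC mulmxA mulVmx // mul1mx.
rewrite mxtrace_tr mulr_natr => <-; rewrite (big_nth 0) big_mkord.
rewrite mulr_natl mulr2n; congr (_ + _); by apply: eq_bigr => i _; rewrite mxE.
Qed.

(* The trace relation forces the eigenvalues of D on the center to agree. *)
Lemma soliton_center_scalar : (0 < size XV)%N ->
  exists la : R, forall z, z \in Z -> D z = la *: z.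
Proof.
move=> n0; have nn0 : (size XV)%:R != 0 :> R by rewrite pnatr_eq0 -lt0n.
have szZ : size XZ = 2%N by rewrite -(dim_orthonormal oZ) sZ.
have [z1 [z2 eX]] : exists z1 z2, XZ = [:: z1; z2].
  by case: (XZ) szZ => [|z1 [|z2 [|]]] // _; exists z1, z2.
have inZ x : x \in XZ -> x \in Z by move=> xX; rewrite -sZ memv_span.
have z1Z : z1 \in Z by apply: inZ; rewrite eX inE eqxx.
have z2Z : z2 \in Z by apply: inZ; rewrite eX !inE eqxx orbT.
have [g11 g12 g22] : [/\ g z1 z1 = 1, g z1 z2 = 0 & g z2 z2 = 1].
  move: oZ; rewrite eX /= => -[-> h [-> _ _]]; split=> //.
  by apply: h; rewrite inE.
have ex x : x \in Z -> x = g x z1 *: z1 + g x z2 *: z2.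
  rewrite -sZ => /(orthonormal_expand oZ); rewrite eX !big_cons big_nil.
  by rewrite addr0.
pose a := g (D z1) z1; pose b := g (D z1) z2; pose d := g (D z2) z2.
have D1 : D z1 = a *: z1 + b *: z2 by exact/ex/soliton_center.
have D2 : D z2 = b *: z1 + d *: z2.
  rewrite [LHS]ex ?soliton_center //; congr (_ *: _ + _).
  by rewrite metricC -soliton_center_sym.
have tr1 x y (la : R) : (x != 0) || (y != 0) -> a * x + b * y = la * x ->
    b * x + d * y = la * y ->
    2%:R * (\sum_(x <- XV) g (D x) x) = la * (size XV)%:R.
  move=> xy0 e1 e2; apply: (@soliton_trace_eigen (x *: z1 + y *: z2)).
  - by rewrite rpredD ?rpredZ.
  - apply: contraTneq xy0 => e0.
    have ex0 : x = 0.
      have := congr1 (g z1) e0; rewrite linearDr /= !linearZr_LR /= g11 g12.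
      by rewrite linear0r mulr0 addr0 mulr1.
    move: e0; rewrite ex0 scale0r add0r => /(congr1 (g z2)).
    by rewrite linearZr_LR /= g22 mulr1 linear0r => ->; rewrite eqxx.
  - rewrite linearD /= !linearZ /= D1 D2 !scalerDr !scalerA addrACA -!scalerDl.
    by congr (_ *: _ + _ *: _); [rewrite -e1|rewrite -e2]; ring.
have b0 : b = 0.
  apply/eqP/negPn/negP => bn0.
  pose s := Num.sqrt ((a - d) ^+ 2 + 4%:R * b ^+ 2).
  have s2 : s ^+ 2 = (a - d) ^+ 2 + 4%:R * b ^+ 2.
    by rewrite sqr_sqrtr // addr_ge0 ?sqr_ge0 // mulr_ge0 ?sqr_ge0 ?ler0n.
  (* Eigenvectors of the symmetric matrix with rows (a, b) and (b, d) for its eigenvalues (a + d +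
     s) / 2 and (a + d - s) / 2. Each has [b] as a coordinate, hence is nonzero. The trace relation
     makes the eigenvalues equal, so s = 0, against s^2 >= 4 b^2 > 0. *)
  have e1 := @tr1 b ((d - a + s) / 2%:R) ((a + d + s) / 2%:R).
  have e2 := @tr1 ((a - d - s) / 2%:R) b ((a + d - s) / 2%:R).
  have bn : 0 < b ^+ 2 by rewrite exprn_even_gt0.
  rewrite bn0 orbT in e2; rewrite bn0 /= in e1.
  have h1 := e1 isT _ _; have h2 := e2 isT _ _.
  have /(mulIf nn0) h3 : (a + d - s) / 2%:R * (size XV)%:R =
     (a + d + s) / 2%:R * (size XV)%:R.
    by rewrite -h1 -?h2 //; field: s2.
  have s0 : s = 0 by lra.
  have b4 : 0 < 4%:R * b ^+ 2 by rewrite mulr_gt0 ?ltr0n.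
  move/esym/eqP: s2; rewrite s0 expr0n /= paddr_eq0 ?sqr_ge0 1?ltW //.
  by rewrite (gt_eqF b4) andbF.
exists a => z zZ; rewrite [in LHS](ex z zZ) [in RHS](ex z zZ) linearD !linearZ /=.
have ad : a = d.
  have t1 : 2%:R * (\sum_(x <- XV) g (D x) x) = a * (size XV)%:R.
    by apply: (@tr1 1 0); rewrite ?oner_eq0 // b0; ring.
  have t2 : 2%:R * (\sum_(x <- XV) g (D x) x) = d * (size XV)%:R.
    by apply: (@tr1 0 1); rewrite ?oner_eq0 ?orbT // b0; ring.
  by apply: (mulIf nn0); rewrite -t1.
rewrite D1 D2 -ad b0 !scale0r add0r addr0 scalerDr !scalerA.
by rewrite !(mulrC a).
Qed.

(** Put psi = D - la / 2. It has trace 0 on the complement, and [psi x, y] + [x, psi y] = 0 because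
    [D] is [la] on brackets. The second fact makes the sum of ricci(x, psi x) over the basis vanish.
    By the soliton equation this sum is also a multiple of tr psi plus the sum of the squared norms
    of the psi x, so psi = 0. *)
Lemma soliton_perp_scalar :
  exists a : R, {in orthov g Z &, forall x y, ricci br g x y = a * g x y}.
Proof.
(* The trace relation determines the eigenvalues only after division by the dimension of the
   complement; for a zero complement any scalar will do. *)
have [n0|n0] := posnP (size XV).
  exists 0 => x y xV yV; move: xV; rewrite -sV (size0nil n0) span_nil memv0.
  by move/eqP->; rewrite linear0l mulr0 (ricci_perp hbr brZ Zcentral oZ oV sZ sV)
    ?mem0v // (size0nil n0) big_nil mulr0 oppr0.
have [la Dla] := soliton_center_scalar n0.
have z0 : vpick Z != 0 by rewrite vpick0 -dimv_eq0 dimZ.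
have trD := soliton_trace_eigen (memv_pick Z) z0 (Dla _ (memv_pick Z)).
pose psi x := D x - (la / 2%:R) *: x.
have trpsi : \sum_(x <- XV) g (psi x) x = 0.
  rewrite (eq_big_seq (fun x => g (D x) x - la / 2%:R)); last first.
    move=> x xX; rewrite linearBl /= linearZl_LR /=.
    suff -> : g x x = 1 by rewrite mulr1.
    elim: (XV) oV xX => //= y Y IH [gy _ oY]; rewrite inE => /orP[/eqP->//|].
    exact: IH.
  rewrite sumrB big_const_seq count_predT iter_addr_0 -[_ *+ size _]mulr_natr.
  by apply: (@mulfI _ 2%:R); rewrite ?pnatr_eq0 // mulrBr trD; field.
have psiV x : x \in orthov g Z -> psi x \in orthov g Z.
  by move=> xV; rewrite rpredB ?rpredZ // soliton_perp.
have derpsi x y : br (psi x) y + br x (psi y) = 0.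
  have e1 : br (psi x) y = br (D x) y - (la / 2%:R) *: br x y.
    by rewrite /psi addrC -scaleNr (bracketPl hbr) scaleNr addrC.
  have e2 : br x (psi y) = br x (D y) - (la / 2%:R) *: br x y.
    by rewrite /psi addrC -scaleNr (bracketPr hbr) scaleNr addrC.
  rewrite e1 e2 addrACA -derD Dla // -opprD -scalerDl; apply/eqP.
  by rewrite subr_eq0; apply/eqP; congr (_ *: _); field.
have ricpsi : \sum_(x <- XV) ricci br g x (psi x) = 0.
  rewrite (eq_big_seq (fun x => - (2%:R^-1 *
     \sum_(f <- XV) g (br x f) (br (psi x) f)))); last first.
    move=> x /inV xV.
    by rewrite (ricci_perp hbr brZ Zcentral oZ oV sZ sV) // psiV.
  rewrite sumrN -mulr_sumr; set S := \sum_(x <- XV) _.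
  have eS : S = \sum_(x <- XV) \sum_(f <- XV) g (br x f) (br x (psi f)).
    rewrite /S exchange_big; apply: eq_bigr => x _; apply: eq_bigr => f _ /=.
    rewrite (bracketC hbr f) (bracketC hbr (psi f)) linearNl /= linearNr /=.
    by rewrite opprK.
  (* Exchanging the two indices rewrites [S] with psi on the second argument of the bracket; adding
     both forms exhibits [psi x, f] + [x, psi f] = 0. *)
  have : S + S = 0.
    rewrite {2}eS /S -big_split big1 // => x _; rewrite -big_split big1 // => f _ /=.
    by rewrite -linearDr /= derpsi linear0r.
  by move/eqP; rewrite -mulr2n mulrn_eq0 => /eqP ->; rewrite mulr0 oppr0.
have ricE x y : ricci br g x y = (c + la / 2%:R) * g x y + g (psi x) y.
  by rewrite soliton_ricci /psi linearBl /= linearZl_LR /=; ring.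
have psi0 x : x \in XV -> psi x = 0.
  move: ricpsi; under eq_bigr => y _ do rewrite ricE (metricC g y).
  rewrite big_split /= -mulr_sumr trpsi mulr0 add0r => /eqP.
  rewrite big_seq psumr_eq0 => [/allP h xX|y _]; last exact: metric_ge0.
  have := h _ xX; rewrite xX /= => /eqP; exact: metric_eq0.
exists (c + la / 2%:R) => x y xV _; rewrite ricE.
suff -> : psi x = 0 by rewrite linear0l addr0.
have xX : x \in <<XV>>%VS by rewrite sV.
rewrite (orthonormal_expand oV xX) /psi linear_sum scaler_sumr -sumrB big_seq.
rewrite big1 // => e eX; rewrite linearZ /= scalerA mulrC -scalerA -scalerBr.
by rewrite -/(psi e) psi0 // scaler0.
Qed.

End NilsolitonPerp.

(** * The flag obstruction to nilsolitons *)

Lemma bracket_span (R : realType) (V : vectType R) (br : V -> V -> V)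
    (X Y : seq V) : is_lie_bracket br ->
  {in X & Y, forall x y, br x y = 0} ->
  {in <<X>>%VS & <<Y>>%VS, forall x y, br x y = 0}.
Proof.
move=> hbr XY x y xX yY; rewrite (coord_span (X := in_tuple X) xX).
rewrite (coord_span (X := in_tuple Y) yY) (bracket_suml hbr) big1 // => i _.
rewrite (bracketZl hbr) (bracket_sumr hbr) big1 ?scaler0 // => j _.
by rewrite (bracketZr hbr) XY ?scaler0 //; apply: mem_nth.
Qed.

(* Comparing the traces of the (scalar) Ricci operator on L / Z and V / M,
   which have the same dimension, all brackets of the remaining vectors vanish. *)
Lemma nilsoliton_flag (R : realType) (V : vectType R) (br : V -> V -> V)
    (g : {dot V for idfun}) (Z L M : {vspace V}) :
  is_lie_bracket br -> (forall x y, br x y \in Z) ->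
  (forall z x, z \in Z -> br z x = 0) -> \dim Z = 2%N ->
  (forall z x, z \in Z -> z != 0 ->
     x \in orthov g Z -> (forall y, g (br x y) z = 0) -> x = 0) ->
  is_nilsoliton br g ->
  (Z <= L)%VS -> (L <= M)%VS -> {in L & M, forall x y, br x y = 0} ->
  (\dim L + \dim M = \dim {:V} + \dim Z)%N ->
  {in orthov g M & orthov g L, forall x y, br x y = 0}.
Proof.
move=> hbr brZ Zc dZ ndeg [c [D [derD solD]]] ZL LM LM0 dLM.
have [XZ oZ sZ] := orthonormal_basis_exists g Z.
have [XL oL sL] := orthonormal_basis_exists g (L :&: orthov g Z).
have [XF oF sF] := orthonormal_basis_exists g (M :&: orthov g L).
have [XN oN sN] := orthonormal_basis_exists g (orthov g M).
have inL x : x \in XL -> x \in (L :&: orthov g Z)%VS.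
  by rewrite -sL => /memv_span.
have inF x : x \in XF -> x \in (M :&: orthov g L)%VS.
  by rewrite -sF => /memv_span.
have inN x : x \in XN -> x \in orthov g M by rewrite -sN => /memv_span.
have perpS (U W : {vspace V}) : (U <= W)%VS -> (orthov g W <= orthov g U)%VS.
  move=> UW; apply/subvP => x /mem_orthovP h; apply/mem_orthovP => y yU.
  by rewrite h // (subvP UW).
have oFN : orthonormal_seq g (XF ++ XN).
  apply: orthonormal_seq_cat => // x y /inF /memv_capP[xM _] /inN /mem_orthovP h.
  by rewrite metricC h.
have sFN : <<XF ++ XN>>%VS = orthov g L.
  apply/eqP; rewrite eqEdim span_cat sF sN subv_add capvSr perpS //=.
  have := dim_orthov g (subvf L); have := dim_orthov g (subvf M).
  have := dim_orthov g LM; have := dimv_disjoint_sum (U := (M :&: orthov g L)%VS)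
    (V := orthov g M).
  rewrite !capfv capvC capvA (capvC _ M) capv_orthov cap0v => ->// e1 e2 e3.
  by rewrite -(leq_add2l (\dim L)) -e3 addnA -e1 -e2.
have oV : orthonormal_seq g (XL ++ XF ++ XN).
  apply: orthonormal_seq_cat => // x y /inL /memv_capP[xL _] yX.
  have : y \in orthov g L by rewrite -sFN memv_span.
  by move/mem_orthovP => h; rewrite metricC h.
have sV : <<XL ++ (XF ++ XN)>>%VS = orthov g Z.
  apply/eqP; rewrite eqEdim span_cat sL sFN subv_add capvSr perpS //=.
  have := dim_orthov g (subvf L); have := dim_orthov g (subvf Z).
  have := dim_orthov g ZL; have := dimv_disjoint_sum (U := (L :&: orthov g Z)%VS)
    (V := orthov g L).
  rewrite !capfv capvC capvA (capvC _ L) capv_orthov cap0v => ->// e1 e2 e3.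
  by rewrite -(leq_add2l (\dim Z)) -e2 addnA -e1 -e3.
(* dim L - dim Z = dim V - dim M is the dimension hypothesis rearranged; it makes the two Ricci
   traces equal, both being [a] times this number. *)
have eqsz : size XL = size XN.
  rewrite -(dim_orthonormal oL) -(dim_orthonormal oN) sL sN.
  apply/eqP; rewrite -(eqn_add2l (\dim Z + \dim M)) addnAC -(dim_orthov g ZL).
  by rewrite dLM -addnA -{1}(capfv (orthov g M)) -dim_orthov ?subvf // addnC.
have [a ha] := soliton_perp_scalar hbr brZ Zc dZ ndeg derD solD oZ oV sZ sV.
pose q x f := g (br x f) (br x f).
have q0 x f : 0 <= q x f by exact: metric_ge0.
have tr X : orthonormal_seq g X -> (<<X>> <= orthov g Z)%VS ->
    a * (size X)%:R = - (2%:R^-1 * \sum_(x <- X) \sum_(f <- XL ++ XF ++ XN) q x f).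
  move=> oX sX; rewrite mulr_sumr -sumrN.
  have XV x : x \in X -> x \in orthov g Z by move=> xX; rewrite (subvP sX) ?memv_span.
  rewrite (eq_big_seq (fun x => a)); last first.
    move=> x xX; rewrite -(ricci_perp hbr brZ Zc oZ oV sZ sV) ?XV // ha ?XV //.
    suff -> : g x x = 1 by rewrite mulr1.
    elim: (X) oX xX => //= y Y IH [gy _ oY]; rewrite inE => /orP[/eqP->//|].
    exact: IH.
  by rewrite big_const_seq count_predT iter_addr_0 mulr_natr.
have trL := tr XL oL _; have trN := tr XN oN _.
have S0 : \sum_(x <- XN) \sum_(f <- XF ++ XN) q x f = 0.
  (* Vectors of L bracket trivially with L and with M, so only brackets with [XN] survive. This sum
     is also part of the trace over [XN]; equality of the traces leaves zero for the other,
     nonnegative, terms. *)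
  have e1 : \sum_(x <- XL) \sum_(f <- XL ++ XF ++ XN) q x f =
            \sum_(x <- XN) \sum_(f <- XL) q x f.
    rewrite exchange_big !big_cat /= [X in X + _]big_seq [X in X + _]big1 ?add0r.
      rewrite [X in X + _]big_seq [X in X + _]big1 ?add0r.
        apply: eq_bigr => f _; apply: eq_bigr => x _.
        by rewrite /q (bracketC hbr) linearNl linearNr /= opprK.
      move=> f /inF /memv_capP[fM _]; rewrite big_seq big1 // => x.
      by move=> /inL /memv_capP[xL _]; rewrite /q LM0 // linear0l.
    move=> f /inL /memv_capP[fL _]; rewrite big_seq big1 // => x.
    by move=> /inL /memv_capP[xL _]; rewrite /q LM0 ?linear0l // (subvP LM).
  have := trL; rewrite e1 sL capvSr eqsz => /(_ isT).
  have := trN; rewrite sN perpS ?(subv_trans ZL) // => /(_ isT) -> /oppr_inj.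
  move/(mulfI (invr_neq0 _)) => h; have {h} := h _; rewrite pnatr_eq0 => /(_ isT).
  under eq_bigr do rewrite big_cat /=.
  by rewrite big_split /= => /eqP; rewrite -subr_eq0 addrAC subrr add0r => /eqP.
rewrite -sN -sFN; apply: bracket_span => // x f xX fX.
apply: (@metric_eq0 _ _ g).
move/eqP: S0; rewrite psumr_eq0 => [/allP/(_ x xX)|y _]; last first.
  by apply: sumr_ge0.
by rewrite /= psumr_eq0 // => /allP/(_ f fX) /eqP.
Qed.

(** * The Lie algebra of a pencil of skew matrices *)

Section InnerProduct.
Variables (R : realType) (d : nat).
Implicit Types u v : 'cV[R]_d.

Lemma innerE u v : inner u v = \sum_i u i 0 * v i 0.
Proof. by rewrite /inner mxE; apply: eq_bigr => i _; rewrite mxE. Qed.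

Lemma innerC u v : inner u v = inner v u.
Proof. by rewrite !innerE; apply: eq_bigr => i _; rewrite mulrC. Qed.

Lemma inner_bilinear : bilinear_for *%R *%R (@inner R d).
Proof.
split=> w c u v /=; rewrite !innerE mulr_sumr -big_split; apply: eq_bigr => i _.
  by rewrite !mxE mulrDl mulrA.
by rewrite !mxE mulrDr mulrCA.
Qed.

Lemma inner_gt0 u : u != 0 -> 0 < inner u u.
Proof.
move=> u0; have h i : 0 <= u i 0 * u i 0 by rewrite -expr2 sqr_ge0.
rewrite lt0r innerE sumr_ge0 // andbT psumr_eq0 //.
apply: contraNN u0 => /allP h0; apply/eqP/matrixP => i j; rewrite ord1 mxE.
by have := h0 i (mem_index_enum _); rewrite /= mulf_eq0 orbb => /eqP.
Qed.

HB.instance Definition _ := bilinear_isBilinear.Build R 'cV[R]_d 'cV[R]_d R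
  *%R *%R (@inner R d) inner_bilinear.
HB.instance Definition _ := isHermitianSesquilinear.Build R 'cV[R]_d
  false idfun (@inner R d)
  (fun u v => etrans (innerC u v) (esym (etrans (congr1 ( *%R^~ _) (expr0 _))
     (mul1r _)))).
HB.instance Definition _ := isDotProduct.Build R 'cV[R]_d (@inner R d) inner_gt0.

(** Packaged as a dot product so that the results on [orthov] also serve the standard inner product,
    next to the unknown metric. *)
Definition inner_dot : {dot 'cV[R]_d for idfun} := @inner R d.

End InnerProduct.

Lemma inner_mulmx (R : realType) m n (A : 'M[R]_(m, n)) u v :
  inner (A *m u) v = inner u (A^T *m v).
Proof. by rewrite /inner trmx_mul mulmxA. Qed.

Lemma Spencil_tr (R : realType) (S : seq (R[i] * nat)) x y :
  (Spencil S x y)^T = - Spencil S x y.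
Proof.
have Sb al k : (Sblock al k x y)^T = - Sblock al k x y.
  by rewrite /Sblock tr_block_mx opp_block_mx !oppr0 !trmx0 linearN /= trmxK opprK.
rewrite /Spencil tr_mxdiag -mxdiagN.
by apply: eq_mxdiag => i; rewrite Sb.
Qed.

Lemma col2_eq (F : Type) (u v : 'cV[F]_2) :
  u 0 0 = v 0 0 -> u 1 0 = v 1 0 -> u = v.
Proof.
move=> h0 h1; apply/matrixP => -[[|[|//]] hi] j; rewrite ord1.
  by rewrite (_ : Ordinal hi = 0) //; exact: val_inj.
by rewrite (_ : Ordinal hi = 1) //; exact: val_inj.
Qed.

Section PencilLieAlgebra.
Variables (R : realType) (m : nat) (J1 J2 : 'M[R]_m).
Variable mu : 'cV[R]_m -> 'cV[R]_m -> 'cV[R]_2.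
Let V : vectType R := ('cV[R]_m * 'cV[R]_2)%type.
Let br : V -> V -> V := lie_of mu.
Implicit Types x y : V.

Hypothesis mu0 : forall X Y, mu X Y 0 0 = inner (J1 *m X) Y.
Hypothesis mu1 : forall X Y, mu X Y 1 0 = inner (J2 *m X) Y.
Hypothesis J1_skew : J1^T = - J1.
Hypothesis J2_skew : J2^T = - J2.

Lemma inner_mu X Y w :
  inner (mu X Y) w = inner ((w 0 0 *: J1 + w 1 0 *: J2) *m X) Y.
Proof.
rewrite innerE big_ord_recl big_ord1.
rewrite (_ : lift ord0 ord0 = 1); last exact: val_inj.
rewrite mu0 mu1 mulmxDl -!scalemxAl linearDl /= !linearZl_LR /=.
by rewrite (mulrC (w 0 0)) (mulrC (w 1 0)).
Qed.

Lemma mu_bilinear : bilinear_for *:%R *:%R mu.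
Proof.
split=> W c u v /=; apply: col2_eq.
- by rewrite 2!mxE !mu0 mulmxDr -scalemxAr linearPl.
- by rewrite 2!mxE !mu1 mulmxDr -scalemxAr linearPl.
- by rewrite 2!mxE !mu0 linearPr.
- by rewrite 2!mxE !mu1 linearPr.
Qed.

Lemma mu_skew X Y : mu X Y = - mu Y X.
Proof.
apply: col2_eq; rewrite mxE.
  by rewrite !mu0 inner_mulmx J1_skew mulNmx linearNr /= innerC.
by rewrite !mu1 inner_mulmx J2_skew mulNmx linearNr /= innerC.
Qed.

Lemma mu_alt X : mu X X = 0.
Proof.
apply/eqP; have /eqP := mu_skew X X; rewrite -addr_eq0 -mulr2n.
by rewrite -scaler_nat scaler_eq0 pnatr_eq0.
Qed.

Lemma mu0l X : mu 0 X = 0.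
Proof.
by apply: col2_eq; rewrite mxE ?mu0 ?mu1 mulmx0 linear0l.
Qed.

Lemma lie_of_mu_bracket : is_lie_bracket br.
Proof.
split=> [|x|x y z].
- have [hl hr] := mu_bilinear.
  split=> w c u v; rewrite /br /lie_of /=; congr pair.
  + by rewrite [RHS]addr0; apply/esym/scaler0.
  + exact: (hl w.1 c u.1 v.1).
  + by rewrite [RHS]addr0; apply/esym/scaler0.
  + exact: (hr w.1 c u.1 v.1).
- by rewrite /br /lie_of mu_alt.
- rewrite /br /lie_of /= !(mu_skew _ 0) !mu0l oppr0.
  by congr pair; rewrite /= !addr0.
Qed.

Definition center_space : {vspace V} := lker (linfun (@fst 'cV[R]_m 'cV[R]_2)).

Lemma mem_center x : (x \in center_space) = (x.1 == 0).
Proof. by rewrite memv_ker lfunE. Qed.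

Lemma dim_V : \dim {:V} = (m + 2)%N.
Proof.
rewrite dimvf (_ : dim V = dim 'cV[R]_m + dim 'cV[R]_2)%N //.
by rewrite !dim_matrix !mulr1.
Qed.

Lemma dim_center_space : \dim center_space = 2%N.
Proof.
have := limg_ker_dim (linfun (@fst 'cV[R]_m 'cV[R]_2)) fullv.
rewrite capfv -/center_space.
have -> : limg (linfun (@fst 'cV[R]_m 'cV[R]_2)) = fullv.
  apply/eqP; rewrite eqEsubv subvf; apply/subvP => u _; apply/memv_imgP.
  by exists (u, 0); rewrite ?memvf // lfunE.
rewrite [X in _ = X]dim_V dimvf dim_matrix mulr1 addnC => /addnI.
by [].
Qed.

Lemma bracket_in_center x y : br x y \in center_space.
Proof. by rewrite mem_center. Qed.

Lemma center_central z x : z \in center_space -> br z x = 0.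
Proof. by rewrite mem_center /br /lie_of => /eqP ->; rewrite mu0l. Qed.

Hypothesis nonsing : forall a b : R, (a != 0) || (b != 0) ->
  a *: J1 + b *: J2 \in unitmx.

(** The functional c -> g (0, c) z is the standard pairing with some [w], nonzero when [z] is
    central and nonzero. Hence g([x, y], z) is the form of the pencil at [w], and invertibility
    there kills the first component of [x]. Then [x] is central and orthogonal to the center. *)
Lemma center_nondegenerate (g : {dot V for idfun}) (z x : V) :
  z \in center_space -> z != 0 -> x \in orthov g center_space ->
  (forall y, g (br x y) z = 0) -> x = 0.
Proof.
move=> zZ z0 /mem_orthovP xZ h.
pose w : 'cV[R]_2 := \col_l g (0, delta_mx l 0) z.
have gw (c : 'cV[R]_2) : g (0, c) z = inner c w.
  have -> : (0, c) = \sum_l c l 0 *: (0, delta_mx l 0) :> V.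
    rewrite big_ord_recl big_ord1; congr pair; first by rewrite /= !scaler0 addr0.
    rewrite /= {1}(matrix_sum_delta c) big_ord_recl !big_ord1 /=.
    by congr (_ *: delta_mx _ _ + _ *: delta_mx _ _); congr (c _ _); exact: ord1.
  rewrite linear_sumlz innerE; apply: eq_bigr => l _.
  by rewrite linearZl_LR /= mxE.
have w0 : (w 0 0 != 0) || (w 1 0 != 0).
  apply: contraNT z0; rewrite negb_or !negbK => /andP[/eqP h0 /eqP h1].
  apply/eqP/(@metric_eq0 _ _ g).
  have ez : z = (0, z.2).
    by move: zZ; rewrite mem_center; case: (z) => a b /= /eqP ->.
  rewrite [X in g X _]ez.
  rewrite gw innerE big_ord_recl big_ord1 h0 mulr0 add0r.
  by rewrite (_ : lift ord0 ord0 = 1) ?h1 ?mulr0 //; apply: val_inj.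
have Px : (w 0 0 *: J1 + w 1 0 *: J2) *m x.1 = 0.
  apply/(@metric_eq0 _ _ (inner_dot R m)).
  have := h ((w 0 0 *: J1 + w 1 0 *: J2) *m x.1, 0).
  by rewrite /br /lie_of gw inner_mu.
have x10 : x.1 = 0 by rewrite -(mulKmx (nonsing w0) x.1) Px mulmx0.
apply: (@metric_eq0 _ _ g); apply: xZ.
by rewrite mem_center x10.
Qed.

End PencilLieAlgebra.

(** * Pencils that admit no nilsoliton *)

(** T^2 + 1 for T = J2 J1. On a block (i t, 1) it is the scalar 1 - t^2; on (i, 2) it is nilpotent
    and nonzero. A projection [E] onto the latter block is needed to discard the blocks with t >
    1. *)
Definition sq_plus1 (F : pzRingType) n (J1 J2 : 'M[F]_n) :=
  (J2 *m J1) *m (J2 *m J1) + 1%:M.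

Lemma sq_plus1_comm (F : pzRingType) n (E J1 J2 : 'M[F]_n) :
  E *m J1 = J1 *m E -> E *m J2 = J2 *m E ->
  E *m sq_plus1 J1 J2 = sq_plus1 J1 J2 *m E.
Proof.
move=> c1 c2; rewrite /sq_plus1 mulmxDr mulmxDl mulmx1 mul1mx; congr (_ + _).
by rewrite !mulmxA c2 -!mulmxA (mulmxA E) c1 -!mulmxA (mulmxA E) c2 -!mulmxA c1.
Qed.

(* With T = J2 J1 and N = E (T^2 + 1), N is a nilpotent part of T at the
   eigenvalues i and -i. The flag is im N < ker N; by the flag lemma the
   metric complement Q of ker N is T-stable, so T^2 + 1 maps it to Q :&: ker N,
   which is 0. Then N = E (T^2 + 1) kills Q as well, and N = 0. *)
Lemma pencil_no_nilsoliton (R : realType) m (J1 J2 E : 'M[R]_m)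
    (mu : 'cV[R]_m -> 'cV[R]_m -> 'cV[R]_2) :
  (forall X Y, mu X Y 0 0 = inner (J1 *m X) Y) ->
  (forall X Y, mu X Y 1 0 = inner (J2 *m X) Y) ->
  J1^T = - J1 -> J2^T = - J2 ->
  (forall a b : R, (a != 0) || (b != 0) -> a *: J1 + b *: J2 \in unitmx) ->
  J2 *m J2 = - 1%:M -> E^T = E -> E *m J1 = J1 *m E -> E *m J2 = J2 *m E ->
  let U := sq_plus1 J1 J2 in E *m (U *m U) = 0 -> E *m U != 0 ->
  ~ admits_nilsoliton (lie_of mu).
Proof.
move=> mu0 mu1 J1s J2s nonsing J22 ET EJ1 EJ2 U EUU N0 [g sol].
have EU : E *m U = U *m E := sq_plus1_comm EJ1 EJ2.
have UT : U^T = J1 *m J2 *m (J1 *m J2) + 1%:M.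
  rewrite linearD /= trmx1 !trmx_mul J1s J2s.
  by rewrite !(mulNmx, mulmxN) !opprK.
(* The transpose of J2 J1 is J1 J2, the two signs cancelling, so J1 and J2 both intertwine [U] with
   [U^T], and N with [N^T]. This yields (J N u, y) = (J u, N y), which is 0 for y in ker N. *)
have J1U : J1 *m U = U^T *m J1.
  by rewrite UT /U /sq_plus1 mulmxDl mulmxDr mulmx1 mul1mx !mulmxA.
have J2U : J2 *m U = U^T *m J2.
  rewrite UT /U /sq_plus1 mulmxDl mulmxDr mulmx1 mul1mx !mulmxA J22.
  by rewrite -!mulmxA J22 !mulNmx !mulmxN mulmx1 mul1mx.
have adjU X : X *m U = U^T *m X -> E *m X = X *m E ->
    X *m (E *m U) = (E *m U)^T *m X.
  move=> XU EX; rewrite trmx_mul ET -mulmxA EX (mulmxA U^T) -XU.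
  by rewrite -mulmxA -EU.
have J1N := adjU _ J1U EJ1; have J2N := adjU _ J2U EJ2.
have NU : E *m U *m U = 0 by rewrite -mulmxA.
have NN : E *m U *m (E *m U) = 0.
  by rewrite {2}EU mulmxA -(mulmxA E) EUU mul0mx.
have [N NE] : exists N, N = E *m U by exists (E *m U).
rewrite -NE in N0 J1N J2N NU NN.
pose V : vectType R := ('cV[R]_m * 'cV[R]_2)%type.
pose Z : {vspace V} := center_space R m.
pose M : {vspace V} := lker (linfun (mulmx N) \o linfun fst)%VF.
have memM (x : V) : (x \in M) = (N *m x.1 == 0).
  by rewrite memv_ker lfunE /= !lfunE.
(* N on the first factor and the identity on the second: the image is im N + Z and the kernel is ker
   N, so rank-nullity gives the dimension condition of the flag. *)
have hl : linear (fun x : V => (N *m x.1, x.2) : V).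
  by move=> c u v; congr pair; rewrite /= mulmxDr -scalemxAr.
pose hL := GRing.isLinear.Build R V V *:%R _ hl.
pose h : {linear V -> V} := HB.pack (fun x : V => (N *m x.1, x.2) : V) hL.
pose L : {vspace V} := limg (linfun h).
have memL (x : V) : reflect (exists u, x.1 = N *m u) (x \in L).
  apply: (iffP idP) => [/memv_imgP[u _ ->]|[u e]].
    by exists u.1; rewrite lfunE.
  by apply/memv_imgP; exists (u, x.2); rewrite ?memvf // lfunE /= -e; case: (x).
have dV : \dim {:V} = (m + 2)%N := dim_V R m.
have dZ : \dim Z = 2%N := dim_center_space R m.
have ZL : (Z <= L)%VS.
  apply/subvP => x; rewrite mem_center => /eqP x0; apply/memL.
  by exists 0; rewrite x0 mulmx0.
have LM : (L <= M)%VS.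
  by apply/subvP => x /memL[u e]; rewrite memM e mulmxA NN mul0mx.
have LM0 : {in L & M, forall x y : V, lie_of mu x y = 0}.
  move=> x y /memL[u eu]; rewrite memM => /eqP ey.
  have J0 J : J *m N = N^T *m J -> inner (J *m x.1) y.1 = 0.
    by move=> JN; rewrite eu mulmxA JN -mulmxA inner_mulmx trmxK ey linear0r.
  have e : mu x.1 y.1 = 0.
    apply: col2_eq; rewrite [RHS]mxE.
      by rewrite mu0; exact: J0.
    by rewrite mu1; exact: J0.
  by rewrite /lie_of e.
have dLM : (\dim L + \dim M = \dim {:V} + \dim Z)%N.
  have dM : \dim M = (\dim (lker (linfun h)) + \dim Z)%N.
    rewrite -dimv_disjoint_sum; last first.
      apply/eqP; rewrite -subv0; apply/subvP => x /memv_capP[].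
      rewrite memv_ker lfunE memv0 mem_center /= => /eqP[_ x2] /eqP x1.
      by move: x1 x2; case: (x) => a b /= -> ->.
    congr (\dim _); apply/eqP; rewrite eqEsubv subv_add.
    rewrite (subv_trans ZL LM) andbT; apply/andP; split; last first.
      by apply/subvP => x; rewrite memv_ker lfunE memM /= => /eqP[-> _].
    apply/subvP => x; rewrite memM => /eqP ex.
    have -> : x = (x.1, 0) + (0, x.2).
      by case: (x) => a b; congr pair; rewrite /= ?addr0 ?add0r.
    apply: memv_add; last by rewrite mem_center.
    rewrite memv_ker lfunE; apply/eqP.
    by rewrite (_ : h (x.1, 0) = (N *m x.1, 0)) // ex.
  have := limg_ker_dim (linfun h) fullv; rewrite capfv -/L => <-.
  by rewrite dM addnA (addnC (\dim L)).
have flag := nilsoliton_flag (lie_of_mu_bracket mu0 mu1 J1s J2s)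
  (@bracket_in_center R m mu) (center_central mu0 mu1) dZ
  (@center_nondegenerate R m J1 J2 mu mu0 mu1 nonsing g) sol ZL LM LM0 dLM.
pose K : {vspace 'cV[R]_m} := (linfun fst @: orthov g L)%VS.
pose Q1 : {vspace 'cV[R]_m} := (linfun fst @: orthov g M)%VS.
have fst_dim (W : {vspace V}) : (Z <= W)%VS ->
    \dim (linfun fst @: orthov g W)%VS = \dim (orthov g W).
  move=> ZW; apply: limg_dim_eq; apply/eqP; rewrite -subv0.
  apply/subvP => x /memv_capP[/mem_orthovP xW]; rewrite -/(center_space R m) => xZ.
  by rewrite memv0; apply/eqP/(@metric_eq0 _ _ g)/xW/(subvP ZW).
(* L and M contain Z, so their [g]-orthogonals meet Z in 0 and project injectively to the first
   factor. The flag lemma gives one inclusion, and dim L + dim M = dim V + dim Z makes it an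
   equality. *)
have ann (J : 'M[R]_m) : J \in unitmx ->
   (forall x y : V, x \in orthov g M -> y \in orthov g L -> inner (J *m x.1) y.1 = 0) ->
   (linfun (mulmx J) @: Q1)%VS = orthov (inner_dot R m) K.
  move=> Ju J0; apply/eqP; rewrite eqEdim; apply/andP; split.
    apply/subvP => _ /memv_imgP[_ /memv_imgP[x xM ->] ->].
    apply/mem_orthovP => _ /memv_imgP[y yL ->]; rewrite !lfunE /=.
    exact: J0.
  have := dim_orthov (inner_dot R m) (subvf K); have := dim_orthov g (subvf L).
  have := dim_orthov g (subvf M).
  rewrite !capfv fst_dim // dV => eM eL; rewrite dimvf dim_matrix mulr1.
  move=> eK; rewrite limg_dim_eq ?fst_dim ?(subv_trans ZL) //; last first.
    apply/eqP; rewrite -subv0; apply/subvP => x /memv_capP[_].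
    rewrite memv_ker lfunE memv0 /= => /eqP e.
    by rewrite -(mulKmx Ju x) e mulmx0.
  have arith (l M' l' q k : nat) : (l + M' = m + 2 + 2 -> m + 2 = M' + q ->
    m + 2 = l + l' -> m = l' + k -> k <= q)%N by lia.
  by move: dLM eM eL eK; rewrite dV dZ; exact: arith.
have J1u : J1 \in unitmx.
  by have := nonsing 1 0; rewrite scale1r scale0r addr0; apply; rewrite oner_eq0.
have J2u : J2 \in unitmx.
  have := nonsing 0 1; rewrite scale1r scale0r add0r; apply.
  by rewrite oner_eq0 orbT.
have flag1 (x y : V) : x \in orthov g M -> y \in orthov g L ->
    inner (J1 *m x.1) y.1 = 0.
  move=> xM yL; rewrite -mu0.
  have [-> //] : mu x.1 y.1 = 0 := congr1 snd (flag x y xM yL).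
  by rewrite mxE.
have flag2 (x y : V) : x \in orthov g M -> y \in orthov g L ->
    inner (J2 *m x.1) y.1 = 0.
  move=> xM yL; rewrite -mu1.
  have [-> //] : mu x.1 y.1 = 0 := congr1 snd (flag x y xM yL).
  by rewrite mxE.
have a1 := ann J1 J1u flag1; have a2 := ann J2 J2u flag2.
(* J1 Q1 and J2 Q1 are the same space, the standard orthogonal of [K]; hence J2 J1 Q1 = J2 J2 Q1 =
   Q1. *)
have stable x : x \in Q1 -> J2 *m J1 *m x \in Q1.
  move=> xQ; have : J1 *m x \in (linfun (mulmx J2) @: Q1)%VS.
    by rewrite a2 -a1; apply/memv_imgP; exists x; rewrite ?lfunE.
  case/memv_imgP => y yQ; rewrite lfunE /= => e.
  by rewrite -mulmxA e mulmxA J22 mulNmx mul1mx rpredN.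
have Q0 x : x \in Q1 -> N *m x = 0 -> x = 0.
  case/memv_imgP => y yM ->; rewrite lfunE /= => Ny.
  suff -> : y = 0 by [].
  apply: (@metric_eq0 _ _ g); move/mem_orthovP: yM; apply.
  by rewrite memM Ny.
have Q10 x : x \in Q1 -> x = 0.
  move=> xQ; apply: (Q0 _ xQ); rewrite NE -mulmxA.
  suff -> : U *m x = 0 by rewrite mulmx0.
  apply: Q0; last by rewrite mulmxA NU mul0mx.
  by rewrite mulmxDl mul1mx rpredD // -mulmxA !stable.
have : orthov g M = 0%VS.
  apply/eqP; rewrite -dimv_eq0 -fst_dim ?(subv_trans ZL) // dimv_eq0 -subv0.
  by apply/subvP => x /Q10 ->; rewrite mem0v.
move=> M0; have := dim_orthov g (subvf M); rewrite capfv M0 dimv0 addn0 => dM.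
have Mf : M = fullv by apply/eqP; rewrite eqEdim subvf /= dM.
case/eqP: N0; apply/matrixP => i j.
have : ((delta_mx j 0, 0) : V) \in M by rewrite Mf memvf.
rewrite memM /= => /eqP/(congr1 (fun A : 'cV_m => A i 0)).
by rewrite -colE !mxE.
Qed.

(** * Explicit computations in the blocks (i, 2) and (i s, 1) *)

Section Blocks.
Variable R : realType.
Implicit Types (a b c d s x y : R) (A : 'M[R]_2).

Lemma mx22E a b c d (M : 'M[R]_2) :
  M 0 0 = a -> M 0 1 = b -> M 1 0 = c -> M 1 1 = d -> M = mx22 a b c d.
Proof.
move=> Ma Mb Mc Md; apply/matrixP => i j; rewrite mxE.
have ord2 (l : 'I_2) : l = 0 \/ l = 1.
  by case: l => -[|[|//]] hl; [left|right]; exact: val_inj.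
by case: (ord2 i) => ->; case: (ord2 j) => ->.
Qed.

Lemma mx22M a b c d a' b' c' d' : mx22 a b c d *m mx22 a' b' c' d' =
  mx22 (a * a' + b * c') (a * b' + b * d') (c * a' + d * c') (c * b' + d * d').
Proof.
by apply: mx22E; rewrite mxE big_ord_recl big_ord1 !mxE.
Qed.

Lemma mx22D a b c d a' b' c' d' : mx22 a b c d + mx22 a' b' c' d' =
  mx22 (a + a') (b + b') (c + c') (d + d').
Proof. by apply: mx22E; rewrite !mxE. Qed.

Lemma mx22N a b c d : - mx22 a b c d = mx22 (- a) (- b) (- c) (- d).
Proof. by apply: mx22E; rewrite !mxE. Qed.

Lemma mx22_tr a b c d : (mx22 a b c d)^T = mx22 a c b d.
Proof. by apply: mx22E; rewrite !mxE. Qed.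

Lemma mx22_scalar a : a%:M = mx22 a 0 0 a.
Proof. by apply: mx22E; rewrite !mxE. Qed.

Lemma mx22_0 : mx22 0 0 0 0 = 0 :> 'M[R]_2.
Proof. by apply/esym/mx22E; rewrite !mxE. Qed.

Lemma sum_ord2 (F : 'I_2 -> 'M[R]_2) : \sum_j F j = F 0 + F 1.
Proof.
rewrite big_ord_recl big_ord1 (_ : lift ord0 ord0 = 1) //; exact: val_inj.
Qed.

Definition blk4 (A B C D : 'M[R]_2) : 'M[R]_(\sum_(i < 2) 2) :=
  \mxblock_(i < 2, j < 2) (if i == 0 then (if j == 0 then A else B)
                           else (if j == 0 then C else D)).

Lemma blk4E (F : 'I_2 -> 'I_2 -> 'M[R]_2) :
  \mxblock_(i < 2, j < 2) F i j = blk4 (F 0 0) (F 0 1) (F 1 0) (F 1 1).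
Proof.
have ord2 (l : 'I_2) : l = 0 \/ l = 1.
  by case: l => -[|[|//]] hl; [left|right]; exact: val_inj.
apply: eq_mxblock => i j.
by case: (ord2 i) => ->; case: (ord2 j) => ->.
Qed.

Lemma blk4M A B C D A' B' C' D' : blk4 A B C D *m blk4 A' B' C' D' =
  blk4 (A *m A' + B *m C') (A *m B' + B *m D')
       (C *m A' + D *m C') (C *m B' + D *m D').
Proof.
by rewrite [LHS]mul_mxblock blk4E; congr blk4; rewrite sum_ord2.
Qed.

Lemma blk4D A B C D A' B' C' D' : blk4 A B C D + blk4 A' B' C' D' =
  blk4 (A + A') (B + B') (C + C') (D + D').
Proof. by rewrite -[LHS]mxblockD blk4E. Qed.

Lemma blk4_tr A B C D : (blk4 A B C D)^T = blk4 A^T C^T B^T D^T.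
Proof. by rewrite [LHS]tr_mxblock blk4E. Qed.

Lemma blk4_scalar a : a%:M = blk4 a%:M 0 0 a%:M.
Proof. by rewrite -[LHS]mxdiagZ /mxdiag blk4E !conform_mx_id. Qed.

Lemma blk4_0 : blk4 0 0 0 0 = 0.
Proof. by rewrite -[RHS]mxblock0 blk4E. Qed.

Lemma blk4_inj A B C D A' B' C' D' : blk4 A B C D = blk4 A' B' C' D' ->
  [/\ A = A', B = B', C = C' & D = D'].
Proof.
rewrite /blk4 => /eq_mxblockP h; split.
- exact: (h 0 0).
- exact: (h 0 1).
- exact: (h 1 0).
- exact: (h 1 1).
Qed.

Lemma Amx1 s x y : Amx ('i%C * s%:C%C)%R 1 x y =
  \mxblock_(i < 1, j < 1) mx22 (- s * x) y y (s * x).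
Proof.
apply: eq_mxblock => i j; rewrite !ord1 /=.
by congr mx22; ring.
Qed.

Lemma Amx2 x y : Amx ('i%C : R[i]) 2 x y =
  blk4 0 (mx22 (- x) y y x) (mx22 (- x) y y x) (mx22 0 x x 0).
Proof.
rewrite [LHS]blk4E /=.
by congr (blk4 _ (mx22 _ _ _ _) (mx22 _ _ _ _) _); ring.
Qed.

Definition blk1 (A : 'M[R]_2) : 'M[R]_(\sum_(i < 1) 2) :=
  \mxblock_(i < 1, j < 1) A.

Lemma blk1M A B : blk1 A *m blk1 B = blk1 (A *m B).
Proof. by rewrite [LHS]mul_mxblock; apply: eq_mxblock => i j; rewrite big_ord1. Qed.

Lemma blk1N A : - blk1 A = blk1 (- A).
Proof. by rewrite -[LHS]mxblockN. Qed.

Lemma blk1_tr A : (blk1 A)^T = blk1 A^T.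
Proof. by rewrite [LHS]tr_mxblock. Qed.

Lemma blk1_scalar a : a%:M = blk1 a%:M.
Proof.
rewrite -[LHS]mxdiagZ /mxdiag; apply: eq_mxblock => i j.
by rewrite !ord1 conform_mx_id.
Qed.

Lemma opp_scalar_block n a :
  - a%:M = block_mx (- a%:M) 0 0 (- a%:M) :> 'M[R]_(n + n).
Proof. by rewrite scalar_mx_block opp_block_mx !oppr0. Qed.

Lemma skew_blockM n (A B : 'M[R]_n) :
  block_mx 0 A (- A^T) 0 *m block_mx 0 B (- B^T) 0 =
  block_mx (- (A *m B^T)) 0 0 (- (A^T *m B)).
Proof.
by rewrite mulmx_block !mulmx0 !mul0mx !addr0 !add0r mulmxN mulNmx.
Qed.

Let al1 s := ('i%C * s%:C%C : R[i])%R.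

Lemma Sblock1_J22 s :
  Sblock (al1 s) 1 0 1 *m Sblock (al1 s) 1 0 1 = - 1%:M.
Proof.
rewrite /Sblock !skew_blockM !Amx1 -!/(blk1 _) !blk1_tr !blk1M !mx22_tr !mx22M.
rewrite opp_scalar_block [1%:M]blk1_scalar mx22_scalar.
by congr (block_mx (- blk1 _) _ _ (- blk1 _)); congr mx22; ring.
Qed.

Lemma Sblock1_J11 s :
  Sblock (al1 s) 1 1 0 *m Sblock (al1 s) 1 1 0 = - (s ^+ 2)%:M.
Proof.
rewrite /Sblock !skew_blockM !Amx1 -!/(blk1 _) !blk1_tr !blk1M !mx22_tr !mx22M.
rewrite opp_scalar_block [_%:M]blk1_scalar mx22_scalar.
by congr (block_mx (- blk1 _) _ _ (- blk1 _)); congr mx22; ring.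
Qed.

Lemma Sblock1_J12 s : Sblock (al1 s) 1 1 0 *m Sblock (al1 s) 1 0 1 =
  - (Sblock (al1 s) 1 0 1 *m Sblock (al1 s) 1 1 0).
Proof.
rewrite /Sblock !skew_blockM !Amx1 -!/(blk1 _) !blk1_tr !blk1M !mx22_tr !mx22M.
rewrite opp_block_mx !oppr0 !blk1N !mx22N.
by congr (block_mx (blk1 _) _ _ (blk1 _)); congr mx22; ring.
Qed.

Lemma Sblock2_J22 :
  Sblock ('i%C : R[i]) 2 0 1 *m Sblock ('i%C : R[i]) 2 0 1 = - 1%:M.
Proof.
have e : Amx ('i%C : R[i]) 2 0 1 *m (Amx ('i%C : R[i]) 2 0 1)^T = 1%:M.
  rewrite Amx2 blk4_tr !mx22_tr -!mx22_0 !mx22_tr blk4M !mx22M !mx22D.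
  by rewrite blk4_scalar mx22_scalar -mx22_0; congr blk4; congr mx22; ring.
by rewrite /Sblock skew_blockM e (mulmx1C e) opp_scalar_block.
Qed.

Let U2 := sq_plus1 (Sblock ('i%C : R[i]) 2 1 0) (Sblock ('i%C : R[i]) 2 0 1).

Let u2 : 'M[R]_(\sum_(i < 2) 2) := blk4 0 (mx22 0 2%:R (- 2%:R) 0) 0 0.

(** With A symmetric, T is minus two copies of A(0,1) A(1,0). That product is the real Jordan block
    with j, where j^2 = -1, on the diagonal and 1 above it; its square plus 1 has the single entry 2
    j. *)
Lemma Sblock2_sq_plus1 : U2 = block_mx u2 0 0 u2.
Proof.
have tr2 x y : (Amx ('i%C : R[i]) 2 x y)^T = Amx ('i%C : R[i]) 2 x y.
  by rewrite Amx2 blk4_tr !mx22_tr trmx0.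
have e : Amx ('i%C : R[i]) 2 0 1 *m Amx ('i%C : R[i]) 2 1 0 =
    blk4 (mx22 0 1 (- 1) 0) 1%:M 0 (mx22 0 1 (- 1) 0).
  rewrite !Amx2 mx22_scalar -!mx22_0 blk4M !mx22M !mx22D.
  by congr blk4; congr mx22; ring.
have e2 : (Amx ('i%C : R[i]) 2 0 1 *m Amx ('i%C : R[i]) 2 1 0) *m
    (Amx ('i%C : R[i]) 2 0 1 *m Amx ('i%C : R[i]) 2 1 0) + 1%:M = u2.
  rewrite e /u2 blk4_scalar mx22_scalar -!mx22_0 blk4M !mx22M !mx22D.
  by rewrite blk4D !mx22D; congr blk4; congr mx22; ring.
rewrite /U2 /sq_plus1 /Sblock !skew_blockM !tr2 mulmx_block scalar_mx_block.
rewrite !(mulmx0, mul0mx, add0r, addr0) !(mulNmx, mulmxN) !opprK.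
by rewrite add_block_mx !addr0 e2.
Qed.

Lemma Sblock2_sq_plus1_nilpotent : U2 *m U2 = 0.
Proof.
rewrite Sblock2_sq_plus1 mulmx_block !(mulmx0, mul0mx, add0r, addr0) /u2.
by rewrite blk4M !(mulmx0, mul0mx, add0r, addr0) blk4_0 block_mx_const.
Qed.

Lemma Sblock2_sq_plus1_neq0 : U2 != 0.
Proof.
rewrite Sblock2_sq_plus1; apply/eqP => h.
have /eq_block_mx[+ _ _ _] : block_mx u2 0 0 u2 = block_mx 0 0 0 0.
  by rewrite h block_mx_const.
rewrite /u2 -blk4_0 => /blk4_inj[_ + _ _].
move/(congr1 (fun M : 'M_2 => M 0 1)); rewrite !mxE /= => /eqP.
by rewrite pnatr_eq0.
Qed.

End Blocks.

(** * Kernels and chains of a pencil over a field *)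

Lemma mulmx_commM (F : pzSemiRingType) n (E A B : 'M[F]_n) :
  E *m A = A *m E -> E *m B = B *m E -> E *m (A *m B) = A *m B *m E.
Proof. by move=> EA EB; rewrite mulmxA EA -mulmxA EB mulmxA. Qed.

Section PencilField.
Variables (F : fieldType) (n : nat) (J1 J2 : 'M[F]_n).
Hypothesis two_neq0 : 2%:R != 0 :> F.
Hypothesis J22 : J2 *m J2 = - 1%:M.

Let P (a b : F) : 'M[F]_n := a *: J1 + b *: J2.

(** Under [E] the matrices J1, J2 satisfy Clifford relations: the pencil squares to the quadratic
    form -(s^2 a^2 + b^2), and this is the polarisation. *)
Lemma pencil_anticomm (E : 'M[F]_n) (s a b a' b' : F) :
  E *m (J1 *m J1) = - s ^+ 2 *: E -> E *m (J1 *m J2 + J2 *m J1) = 0 ->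
  E *m (P a b *m P a' b' + P a' b' *m P a b) =
    - (2%:R * (s ^+ 2 * (a * a') + b * b')) *: E.
Proof.
move=> E1 E2.
have -> : P a b *m P a' b' + P a' b' *m P a b =
   (2%:R * (a * a')) *: (J1 *m J1) + (a * b' + a' * b) *: (J1 *m J2 + J2 *m J1)
   + (2%:R * (b * b')) *: (J2 *m J2).
  rewrite /P !mulmxDl !mulmxDr -!scalemxAl -!scalemxAr !scalerA.
  by apply/matrixP => i j; rewrite !mxE; ring.
rewrite 2!(mulmxDr E) -!scalemxAr E1 E2 J22 mulmxN mulmx1 scaler0 addr0 scalerN.
by rewrite -scaleNr scalerA -scalerDl; congr (_ *: _); ring.
Qed.

Lemma pencil_sq (E : 'M[F]_n) (s a b : F) :
  E *m (J1 *m J1) = - s ^+ 2 *: E -> E *m (J1 *m J2 + J2 *m J1) = 0 ->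
  E *m (P a b *m P a b) = - (s ^+ 2 * a ^+ 2 + b ^+ 2) *: E.
Proof.
move=> E1 E2; have := pencil_anticomm a b a b E1 E2.
rewrite -mulr2n -scaler_nat -scalemxAr => h.
apply: (scalerI two_neq0); rewrite h scalerA; congr (_ *: _); ring.
Qed.

Lemma pencil_unit (s a b : F) :
  J1 *m J1 = - (s ^+ 2)%:M -> J1 *m J2 + J2 *m J1 = 0 ->
  s ^+ 2 * a ^+ 2 + b ^+ 2 != 0 -> P a b \in unitmx.
Proof.
move=> h1 h2 c0; have := @pencil_sq 1%:M s a b.
rewrite !mul1mx h1 h2 scalemx1 -raddfN /= => /(_ erefl erefl).
set c := s ^+ 2 * a ^+ 2 + b ^+ 2 in c0 * => e.
have : P a b *m ((- c)^-1 *: P a b) = 1%:M.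
  by rewrite -scalemxAr e scalemx1 scale_scalar_mx mulVf ?oppr_eq0.
by case/mulmx1_unit.
Qed.

(** At an isotropic point the pencil squares to 0, which bounds the rank by n / 2. Its
    anticommutator with J2 is the invertible scalar -2 b, which bounds n by twice the rank. *)
Lemma pencil_rank_half (s a b : F) :
  J1 *m J1 = - (s ^+ 2)%:M -> J1 *m J2 + J2 *m J1 = 0 ->
  s ^+ 2 * a ^+ 2 + b ^+ 2 = 0 -> b != 0 -> (\rank (P a b) * 2 = n)%N.
Proof.
move=> h1 h2 c0 b0; have e1 := @pencil_sq 1%:M s a b.
have e2 := @pencil_anticomm 1%:M s a b 0 1.
rewrite !mul1mx h1 h2 scalemx1 -raddfN /= in e1 e2.
move: (e1 erefl erefl) (e2 erefl erefl) => {e1 e2}.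
have -> : P 0 1 = J2 by rewrite /P scale0r scale1r add0r.
rewrite c0 oppr0 scale0r => /mulmx0_rank_max e1.
rewrite !mulr0 add0r mulr1 => e2.
apply/eqP; rewrite eqn_leq muln2 -addnn e1 /=.
rewrite -[X in (X <= _)%N](mxrank1 F n).
have -> : 1%:M = (- (2%:R * b))^-1 *: (P a b *m J2 + J2 *m P a b).
  by rewrite e2 scalerA mulVf ?scale1r // oppr_eq0 mulf_neq0.
apply: leq_trans (mxrank_scale _ _) _; apply: leq_trans (mxrank_add _ _) _.
by rewrite leq_add // ?mxrankM_maxl ?mxrankM_maxr.
Qed.

Lemma sq_excluded p (E : 'M[F]_n) (s a b : F) (X : 'M[F]_(n, p)) :
  E *m (J1 *m J1) = - s ^+ 2 *: E -> E *m (J1 *m J2 + J2 *m J1) = 0 ->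
  P a b *m X = 0 -> s ^+ 2 * a ^+ 2 + b ^+ 2 != 0 -> E *m X = 0.
Proof.
move=> E1 E2 X0 c0; apply: (scalerI c0); rewrite scaler0.
apply/eqP; rewrite -oppr_eq0 -scaleNr scalemxAl -(pencil_sq _ _ E1 E2).
by rewrite -!mulmxA X0 !mulmx0.
Qed.

(** Blocks with Clifford relations have no chain of length two. If P X = 0 and P Y = P' X, then (P
    P' + P' P) X = P^2 Y, which is 0 under [E] at an isotropic point. So (a, b) would be orthogonal
    to (a', b'), but in a nondegenerate plane an isotropic vector is orthogonal only to its own
    multiples. *)
Lemma chain_excluded p (E : 'M[F]_n) (s a b a' b' : F) (X Y : 'M[F]_(n, p)) :
  E *m J1 = J1 *m E -> E *m J2 = J2 *m E ->
  E *m (J1 *m J1) = - s ^+ 2 *: E -> E *m (J1 *m J2 + J2 *m J1) = 0 -> s != 0 ->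
  P a b *m X = 0 -> P a b *m Y = P a' b' *m X -> a * b' - b * a' != 0 ->
  E *m X = 0.
Proof.
move=> c1 c2 E1 E2 s0 X0 Y0 ind.
have EP c d : E *m P c d = P c d *m E.
  by rewrite /P mulmxDl mulmxDr -!scalemxAl -!scalemxAr c1 c2.
have scal0 (c : F) : c *: (E *m X) = 0 -> c != 0 -> E *m X = 0.
  by move=> /eqP; rewrite scaler_eq0 => /orP[/eqP->|/eqP//]; rewrite eqxx.
have [c0|c0] := eqVneq (s ^+ 2 * a ^+ 2 + b ^+ 2) 0; last first.
  exact: sq_excluded E1 E2 X0 c0.
have h2 : (2%:R * (s ^+ 2 * (a * a') + b * b')) *: (E *m X) = 0.
  apply/eqP; rewrite -oppr_eq0 -scaleNr scalemxAl -(pencil_anticomm _ _ _ _ E1 E2).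
  rewrite -mulmxA mulmxDl -(mulmxA (P a' b')) X0 mulmx0 addr0.
  rewrite -mulmxA -Y0 (mulmxA (P a b)) (mulmxA E) (pencil_sq _ _ E1 E2) c0.
  by rewrite oppr0 scale0r mul0mx.
apply: (scal0 _ h2); apply: contraNneq ind => /eqP.
rewrite mulf_eq0 (negPf two_neq0) /= => /eqP k0.
have : b * (a * b' - b * a') = 0.
  have -> : b * (a * b' - b * a') = a * (s ^+ 2 * (a * a') + b * b') -
     a' * (s ^+ 2 * a ^+ 2 + b ^+ 2) by ring.
  by rewrite k0 c0 !mulr0 subrr.
move/eqP; rewrite mulf_eq0 => /orP[/eqP b0|//].
move/eqP: c0; rewrite b0 expr0n addr0 mulf_eq0 !expf_eq0 /= (negPf s0) /=.
by move/eqP->; rewrite !mul0r subrr.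
Qed.

Let T := J2 *m J1.
Let U := sq_plus1 J1 J2.

Lemma pencil_T : J1 = - (J2 *m T).
Proof. by rewrite /T mulmxA J22 mulNmx mul1mx opprK. Qed.

(** P X = 0 means a T X = b X, whence a^2 U X = (a^2 + b^2) X. Where [U] is nilpotent this forces X
    = 0 unless (a, b) is isotropic. *)
Lemma kernel_excluded p (E : 'M[F]_n) (a b : F) (X : 'M[F]_(n, p)) :
  E *m T = T *m E -> E *m (U *m U) = 0 -> a ^+ 2 + b ^+ 2 != 0 ->
  P a b *m X = 0 -> E *m X = 0.
Proof.
move=> ET EU c0 X0.
have TX : a *: (T *m X) = b *: X.
  have : J2 *m (P a b *m X) = 0 by rewrite X0 mulmx0.
  rewrite /P !mulmxDl mulmxDr -!scalemxAl -!scalemxAr !mulmxA J22 mulNmx mul1mx.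
  by rewrite scalerN => /eqP; rewrite subr_eq0 => /eqP.
have UX : a ^+ 2 *: (U *m X) = (a ^+ 2 + b ^+ 2) *: X.
  rewrite /U /sq_plus1 -/T mulmxDl mul1mx scalerDr addrC scalerDl; congr (_ + _).
  rewrite expr2 -scalerA -mulmxA scalemxAr TX -scalemxAr scalerA mulrC -scalerA.
  by rewrite TX scalerA.
have EUX : E *m (U *m X) = 0.
  apply: (scalerI c0); rewrite scaler0 !scalemxAr -UX -!scalemxAr.
  by rewrite (mulmxA U U) mulmxA EU mul0mx scaler0.
by apply: (scalerI c0); rewrite scaler0 scalemxAr -UX -scalemxAr EUX scaler0.
Qed.

Lemma pencil_nilpotent_unit (a b : F) : U *m U = 0 -> a ^+ 2 + b ^+ 2 != 0 ->
  P a b \in unitmx.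
Proof.
move=> UU c0; rewrite -unitmx_tr -row_free_unit -kermx_eq0; apply/rowV0P => u.
move=> /sub_kermxP /(congr1 trmx); rewrite trmx_mul trmxK trmx0 => h.
apply: trmx_inj; rewrite trmx0 -[LHS]mul1mx.
by apply: kernel_excluded h => //; rewrite ?mul1mx ?mulmx1.
Qed.

End PencilField.

(** * Block projections and the pencils of the family *)

Section BlockProjections.
Variables (F : pzSemiRingType) (p : nat) (p_ : 'I_p -> nat).

Lemma mul_mxdiag (A B : forall i, 'M[F]_(p_ i)) :
  \mxdiag_i A i *m \mxdiag_i B i = \mxdiag_i (A i *m B i).
Proof.
rewrite [X in _ *m X]/mxdiag mul_mxdiag_mxblock; apply: eq_mxblock => i j.
by case: eqVneq => [->|]; rewrite ?conform_mx_id ?mulmx0.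
Qed.

Lemma scale_mxdiag c (A : forall i, 'M[F]_(p_ i)) :
  c *: \mxdiag_i A i = \mxdiag_i (c *: A i).
Proof.
rewrite -mul_scalar_mx -mxdiagZ mul_mxdiag.
by apply: eq_mxdiag => i; rewrite mul_scalar_mx.
Qed.

Definition block_proj l : 'M[F]_(\sum_i p_ i) := \mxdiag_i ((i == l)%:R%:M).

Lemma block_projM l (B : forall i, 'M[F]_(p_ i)) :
  block_proj l *m \mxdiag_i B i = \mxdiag_i B i *m block_proj l.
Proof.
rewrite !mul_mxdiag; apply: eq_mxdiag => i.
by case: (i == l); rewrite ?mul1mx ?mulmx1 // raddf0 ?mul0mx ?mulmx0.
Qed.

Lemma block_proj_eq l (A B : forall i, 'M[F]_(p_ i)) : A l = B l ->
  block_proj l *m \mxdiag_i A i = block_proj l *m \mxdiag_i B i.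
Proof.
move=> AB; rewrite !mul_mxdiag; apply: eq_mxdiag => i.
by case: eqVneq => [->|_]; rewrite ?AB // !raddf0 !mul0mx.
Qed.

Lemma sum_block_proj : \sum_l block_proj l = 1%:M.
Proof.
rewrite /block_proj -mxdiag_sum -[RHS]mxdiagZ; apply: eq_mxdiag => i.
rewrite (bigD1 i) //= eqxx big1 ?addr0 // => j /negPf.
by rewrite eq_sym => ->; rewrite raddf0.
Qed.

Lemma block_proj_tr l : (block_proj l)^T = block_proj l.
Proof. by rewrite tr_mxdiag; apply: eq_mxdiag => i; rewrite tr_scalar_mx. Qed.

End BlockProjections.

Lemma map_mxdiag (F F' : pzRingType) (f : {rmorphism F -> F'}) p
    (p_ : 'I_p -> nat) (A : forall i, 'M[F]_(p_ i)) :
  map_mx f (\mxdiag_i A i) = \mxdiag_i map_mx f (A i).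
Proof.
have conf m n m' n' (B : 'M[F]_(m, n)) :
    map_mx f (conform_mx (0 : 'M_(m', n')) B) = conform_mx 0 (map_mx f B).
  by rewrite map_conform_mx map_mx0.
rewrite /mxdiag; apply/matrixP => i j; rewrite [LHS]mxE [in LHS]mxE [RHS]mxE.
by case: eqVneq => [e|_]; rewrite -?conf ?mxE ?rmorph0.
Qed.

Section FamilyPencil.
Variables (R : realType) (t : seq R).
Let S := S_fam t.
Let J x y := Spencil S x y.
Let U := sq_plus1 (J 1 0) (J 0 1).
Let blk (l : 'I_(size S)) x y : 'M[R]_(bdim l) :=
  Sblock (tnth (in_tuple S) l).1 (tnth (in_tuple S) l).2 x y.

Definition fam_proj (l : 'I_(size S)) : 'M[R]_(Sdim S) :=
  block_proj R (@bdim R S) l.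

Lemma fam_index (l : 'I_(size S)) :
  (l = ord0 /\ tnth (in_tuple S) l = ('i%C, 2%N)) \/
  (l != ord0 /\ exists2 s, s \in t &
     tnth (in_tuple S) l = (('i%C * s%:C%C)%R, 1%N)).
Proof.
case: l => -[|l] hl; [left|right]; first by split; first exact: val_inj.
split=> //; have hl' : (l < size t)%N by move: hl; rewrite /= size_map.
exists t`_l; first exact: mem_nth.
by rewrite (tnth_nth ('i%C, 2%N)) /= (nth_map 0).
Qed.

Lemma fam_J22 : J 0 1 *m J 0 1 = - 1%:M.
Proof.
rewrite /J /Spencil mul_mxdiag -[1%:M]mxdiagZ -mxdiagN; apply: eq_mxdiag => l.
(* The size of a block depends on its pair, so the pair is generalised to a variable before being
   replaced by its value. *)
have h p : p = ('i%C, 2%N) \/ (exists s, p = (('i%C * s%:C%C)%R, 1%N)) ->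
    Sblock p.1 p.2 0 1 *m Sblock p.1 p.2 0 1 = - 1%:M :> 'M[R]_(_ + _).
  by case=> [->|[s ->]]; [exact: Sblock2_J22|exact: Sblock1_J22].
by apply: h; have [[_ e]|[_ [s _ e]]] := fam_index l; [left|right; exists s].
Qed.

Lemma fam_projM l x y : fam_proj l *m J x y = J x y *m fam_proj l.
Proof. exact: block_projM. Qed.

Lemma fam_proj_tr l : (fam_proj l)^T = fam_proj l.
Proof. exact: block_proj_tr. Qed.

Lemma fam_proj_sum : \sum_l fam_proj l = 1%:M.
Proof. exact: sum_block_proj. Qed.

Lemma fam_UE : U = \mxdiag_l sq_plus1 (blk l 1 0) (blk l 0 1).
Proof.
rewrite /U /sq_plus1 /J /Spencil -!/(blk _ _ _) !mul_mxdiag -[1%:M]mxdiagZ.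
by rewrite -mxdiagD.
Qed.

Lemma fam_proj0_nilpotent : fam_proj ord0 *m (U *m U) = 0.
Proof.
rewrite fam_UE mul_mxdiag /fam_proj.
rewrite (block_proj_eq (B := fun=> 0)) ?mxdiag0 ?mulmx0 //.
exact: Sblock2_sq_plus1_nilpotent.
Qed.

Lemma fam_proj0_neq0 : fam_proj ord0 *m U != 0.
Proof.
rewrite fam_UE mul_mxdiag; apply/eqP.
move/(congr1 (fun M => submxblock M ord0 ord0)).
rewrite submxblock_diag submxblock0 eqxx mul1mx.
by apply/eqP; exact: Sblock2_sq_plus1_neq0.
Qed.

Lemma fam_proj1 l : l != ord0 -> exists2 s, s \in t &
  fam_proj l *m (J 1 0 *m J 1 0) = - s ^+ 2 *: fam_proj l /\
  fam_proj l *m (J 1 0 *m J 0 1 + J 0 1 *m J 1 0) = 0.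
Proof.
move=> l0; have [[e _]|[_ [s st e]]] := fam_index l; first by rewrite e eqxx in l0.
exists s => //; split.
  rewrite /J /Spencil mul_mxdiag /fam_proj.
  rewrite (block_proj_eq (B := fun=> (- s ^+ 2)%:M)) ?mxdiagZ.
    by rewrite mul_mx_scalar.
  have h p : p = (('i%C * s%:C%C)%R, 1%N) ->
      Sblock p.1 p.2 1 0 *m Sblock p.1 p.2 1 0 = (- s ^+ 2)%:M :> 'M[R]_(_ + _).
    by move=> ->; rewrite raddfN; exact: Sblock1_J11.
  exact: h.
have -> : J 1 0 *m J 0 1 + J 0 1 *m J 1 0 =
    \mxdiag_l (blk l 1 0 *m blk l 0 1 + blk l 0 1 *m blk l 1 0).
  by rewrite mxdiagD -!mul_mxdiag.
rewrite /fam_proj.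
rewrite (block_proj_eq (B := fun=> 0)) ?mxdiag0 ?mulmx0 //.
have h p : p = (('i%C * s%:C%C)%R, 1%N) ->
    Sblock p.1 p.2 1 0 *m Sblock p.1 p.2 0 1 +
    Sblock p.1 p.2 0 1 *m Sblock p.1 p.2 1 0 = 0 :> 'M[R]_(_ + _).
  by move=> ->; apply/eqP; rewrite addr_eq0; apply/eqP; exact: Sblock1_J12.
exact: h.
Qed.

Lemma Sdim_fam : Sdim S = (8 + 4 * size t)%N.
Proof.
rewrite /Sdim.
have -> : (\sum_(l < size S) bdim l = \sum_(p <- S) (4 * p.2))%N.
  rewrite (big_tnth _ _ S) /=; apply: eq_bigr => l _.
  by rewrite /bdim !sum_nat_const !card_ord -mulnDr mulnC.
rewrite big_cons big_map /= (eq_bigr (fun=> 4%N)) // big_const_seq count_predT.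
by rewrite iter_addn_0 mulnC.
Qed.

Lemma fam_tr x y : (J x y)^T = - J x y.
Proof. exact: Spencil_tr. Qed.

Lemma mu_of_row l a b X Y : (l == 0)%:R = a -> (l == 1)%:R = b ->
  mu_of S X Y l 0 = inner (J a b *m X) Y.
Proof. by move=> <- <-; rewrite mxE. Qed.

Lemma mu_of_row0 X Y : mu_of S X Y 0 0 = inner (J 1 0 *m X) Y.
Proof. exact: mu_of_row. Qed.

Lemma mu_of_row1 X Y : mu_of S X Y 1 0 = inner (J 0 1 *m X) Y.
Proof. exact: mu_of_row. Qed.

Hypothesis ht : all (>= 1) t.

Let t_ge1 s : s \in t -> 1 <= s.
Proof. by move/(allP ht). Qed.

(** A kernel vector is split by the block projections. Each component vanishes because s^2 a^2 + b^2
    is definite over the reals, with s = 1 for the block (i, 2). *)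
Lemma fam_nonsing (a b : R) : (a != 0) || (b != 0) ->
  a *: J 1 0 + b *: J 0 1 \in unitmx.
Proof.
move=> ab0; have two0 : 2%:R != 0 :> R by rewrite pnatr_eq0.
have pos (s : R) : s != 0 -> s ^+ 2 * a ^+ 2 + b ^+ 2 != 0.
  have c0 : 0 <= s ^+ 2 * a ^+ 2 by rewrite mulr_ge0 ?sqr_ge0.
  move=> s0; rewrite (paddr_eq0 c0 (sqr_ge0 b)) mulf_eq0 !expf_eq0 /=.
  by rewrite (negPf s0) negb_and.
rewrite -unitmx_tr -row_free_unit -kermx_eq0; apply/rowV0P => u.
move=> /sub_kermxP /(congr1 trmx); rewrite trmx_mul trmxK trmx0 => h.
apply: trmx_inj; rewrite trmx0 -[LHS]mul1mx -fam_proj_sum mulmx_suml big1 // => l _.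
have [->|/fam_proj1[s st [E1 E2]]] := eqVneq l ord0.
  apply: (kernel_excluded fam_J22 _ fam_proj0_nilpotent _ h).
    exact: mulmx_commM (fam_projM _ _ _) (fam_projM _ _ _).
  by have := pos 1; rewrite expr1n mul1r oner_eq0; apply.
apply: (sq_excluded two0 fam_J22 E1 E2 h); apply: pos.
by rewrite gt_eqF // (lt_le_trans ltr01) // t_ge1.
Qed.

Lemma fam_no_nilsoliton : ~ admits_nilsoliton (lie_of (mu_of S)).
Proof.
exact: (pencil_no_nilsoliton mu_of_row0 mu_of_row1 (fam_tr _ _)
  (fam_tr _ _) fam_nonsing fam_J22 (fam_proj_tr ord0) (fam_projM _ _ _)
  (fam_projM _ _ _) fam_proj0_nilpotent fam_proj0_neq0).
Qed.

End FamilyPencil.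

(** * Type, nilpotency step and indecomposability *)

Section NonsingularStructure.
Variables (R : realType) (m : nat) (J1 J2 : 'M[R]_m).
Variable mu : 'cV[R]_m -> 'cV[R]_m -> 'cV[R]_2.
Let V : vectType R := ('cV[R]_m * 'cV[R]_2)%type.
Let br : V -> V -> V := lie_of mu.

Hypothesis mu0 : forall X Y, mu X Y 0 0 = inner (J1 *m X) Y.
Hypothesis mu1 : forall X Y, mu X Y 1 0 = inner (J2 *m X) Y.
Hypothesis J1_skew : J1^T = - J1.
Hypothesis J2_skew : J2^T = - J2.
Hypothesis nonsing : forall a b : R, (a != 0) || (b != 0) ->
  a *: J1 + b *: J2 \in unitmx.
Hypothesis m_gt0 : (0 < m)%N.

Lemma col2_neq0 (u : 'cV[R]_2) : (u 0 0 != 0) || (u 1 0 != 0) = (u != 0).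
Proof.
apply/idP/idP => [|u0].
  by apply: contraTneq => ->; rewrite !mxE eqxx.
apply: contraNT u0; rewrite negb_or !negbK => /andP[/eqP h0 /eqP h1].
by apply/eqP/col2_eq; rewrite mxE.
Qed.

Lemma inner_eq0 d (u : 'cV[R]_d) : (forall v, inner u v = 0) -> u = 0.
Proof. by move=> h; apply: (@metric_eq0 _ _ (inner_dot R d)); exact: h. Qed.

Lemma mu_nondegenerate X u : X != 0 -> (forall Y, inner (mu X Y) u = 0) -> u = 0.
Proof.
move=> X0 h; apply/eqP/negPn/negP; rewrite -col2_neq0 => /nonsing Pu.
case/eqP: X0; rewrite -(mulKmx Pu X) (_ : _ *m X = 0) ?mulmx0 //.
by apply: inner_eq0 => Y; rewrite -(inner_mu mu0 mu1).
Qed.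

(** Brackets with one fixed nonzero [X] already fill the second factor, since a vector orthogonal to
    all of them is a direction where the pencil kills [X]. *)
Lemma mu_span X (W : {vspace 'cV[R]_2}) : X != 0 ->
  (forall Y, mu X Y \in W) -> W = fullv.
Proof.
move=> X0 h; apply/eqP; rewrite eqEdim subvf.
rewrite (dim_orthov (inner_dot R 2) (subvf W)) capfv.
suff -> : orthov (inner_dot R 2) W = 0%VS by rewrite dimv0 addn0 leqnn.
apply/eqP; rewrite -subv0; apply/subvP => u /mem_orthovP uW.
rewrite memv0; apply/eqP/(mu_nondegenerate X0) => Y.
by rewrite innerC; apply: uW; exact: h.
Qed.

Let X0 : 'cV[R]_m := const_mx 1.

Let X0_neq0 : X0 != 0.
Proof.
apply/eqP => /matrixP/(_ (Ordinal m_gt0) 0); rewrite !mxE => /eqP.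
by rewrite oner_eq0.
Qed.

Lemma of_type_pencil : of_type 2 m mu.
Proof.
split; first by [].
- exact: (mu_bilinear mu0 mu1).
- exact: (mu_skew mu0 mu1 J1_skew J2_skew).
- by move=> W h; exact: mu_span X0_neq0 _.
Qed.

Lemma two_step_pencil : two_step br.
Proof.
split; first exact: (lie_of_mu_bracket mu0 mu1 J1_skew J2_skew).
  have P1 : J1 \in unitmx.
    have := @nonsing 1 0; rewrite scale1r scale0r addr0; apply.
    by rewrite oner_eq0.
  exists (X0, 0), (J1 *m X0, 0); apply/eqP => /(congr1 snd) /= h.
  have /eqP : mu X0 (J1 *m X0) 0 0 = 0 by rewrite h mxE.
  rewrite mu0 => /eqP /(@metric_eq0 _ _ (inner_dot R m)) JX.
  by case/eqP: X0_neq0; rewrite -(mulKmx P1 X0) JX mulmx0.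
move=> x y z; apply: (center_central mu0 mu1); exact: bracket_in_center.
Qed.

Lemma ideal_dichotomy (I : {vspace V}) : is_ideal br I ->
  (I <= center_space R m)%VS \/ (center_space R m <= I)%VS.
Proof.
move=> idI; have [h|/subvPn[x xI]] := boolP (I <= center_space R m)%VS.
  by left.
rewrite mem_center => x0; right.
have hl : linear (fun c : 'cV[R]_2 => (0, c) : V).
  by move=> c u v; congr pair; rewrite /= scaler0 addr0.
pose hL := GRing.isLinear.Build R 'cV[R]_2 V *:%R _ hl.
pose h : {linear 'cV[R]_2 -> V} := HB.pack (fun c : 'cV[R]_2 => (0, c) : V) hL.
have hmem c : (c \in (linfun h @^-1: I)%VS) = ((0, c) \in I).
  by rewrite -memv_preim lfunE.
have W : (linfun h @^-1: I)%VS = fullv.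
  apply: (mu_span x0) => Y; rewrite hmem.
  have := idI (Y, 0) x xI; rewrite /br /lie_of /=.
  rewrite (mu_skew mu0 mu1 J1_skew J2_skew) => hI.
  suff -> : (0, mu x.1 Y) = - (0, - mu x.1 Y) :> V by rewrite memvN.
  by congr pair; rewrite /= ?oppr0 ?opprK.
apply/subvP => z; rewrite mem_center => /eqP z0.
have -> : z = (0, z.2) by move: z0; case: (z) => a b /= ->.
by rewrite -hmem W memvf.
Qed.

(** By the dichotomy, two complementary ideals cannot both contain the center, nor both lie in it,
    for their sum is everything. If one lies in the center and the other contains it, the first is
    their intersection, hence zero. *)
Lemma indecomposable_pencil : indecomposable br.
Proof.
case=> I1 [I2 [id1 id2 [I10 I20] sI cI]].
have Z0 : center_space R m != 0%VS.
  by rewrite -dimv_eq0 dim_center_space.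
have cases (A B : {vspace V}) : is_ideal br A -> is_ideal br B ->
    A != 0%VS -> (A + B)%VS = fullv -> (A :&: B)%VS = 0%VS ->
    (A <= center_space R m)%VS -> False.
  move=> idA idB A0 sAB cAB AZ.
  have [BZ|ZB] := ideal_dichotomy idB; last first.
    by case/eqP: A0; apply/eqP; rewrite -subv0 -cAB subv_cap subvv (subv_trans AZ).
  have ABZ : (A + B <= center_space R m)%VS by rewrite subv_add AZ.
  have := subvP ABZ (X0, 0); rewrite sAB memvf => /(_ isT).
  by rewrite mem_center /= (negPf X0_neq0).
have [h1|h1] := ideal_dichotomy id1; first exact: cases I10 sI cI h1.
have [h2|h2] := ideal_dichotomy id2.
  by apply: (cases I2 I1) h2 => //; rewrite ?(addvC I2) ?(capvC I2).
by case/eqP: Z0; apply/eqP; rewrite -subv0 -cI subv_cap h1.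
Qed.

End NonsingularStructure.

Lemma fam_structure (R : realType) (t : seq R) : all (>= 1) t ->
  let mu := mu_of (S_fam t) in
  [/\ of_type 2 (8 + 4 * size t) mu, two_step (lie_of mu),
      indecomposable (lie_of mu), nonsingular mu
    & ~ admits_nilsoliton (lie_of mu)].
Proof.
move=> ht mu; have m0 : (0 < Sdim (S_fam t))%N by rewrite Sdim_fam.
have mu0 := @mu_of_row0 R t; have mu1 := @mu_of_row1 R t.
have J1s := fam_tr t 1 0; have J2s := fam_tr t 0 1.
have ns := fam_nonsing ht.
split.
- have [[_ _] ? ? ?] := of_type_pencil mu0 mu1 J1s J2s ns m0.
  by split=> //; rewrite Sdim_fam.
- exact: two_step_pencil mu0 mu1 J1s J2s ns m0.
- exact: indecomposable_pencil mu0 mu1 J1s J2s ns m0.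
- move=> Z; rewrite -col2_neq0 => Z0; rewrite Jmx_mu_of Spencil_lin.
  exact: ns.
- exact: fam_no_nilsoliton.
Qed.

(** * From Lie isomorphisms to congruences of pencils *)

Lemma linear_col_mx (F : fieldType) m n (phi : 'cV[F]_m -> 'cV[F]_n) :
  linear phi -> exists Q : 'M_(n, m), forall X, phi X = Q *m X.
Proof.
move=> lphi; pose L := GRing.isLinear.Build F 'cV[F]_m 'cV[F]_n *:%R phi lphi.
pose f : {linear 'cV[F]_m -> 'cV[F]_n} := HB.pack phi L.
exists (\matrix_(i, j) f (delta_mx j 0) i 0) => X.
rewrite -[phi X]/(f X) {1}(matrix_sum_delta X) linear_sum.
apply/matrixP => i j; rewrite ord1 summxE mxE; apply: eq_bigr => l _.
by rewrite big_ord1 linearZ /= !mxE mulrC.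
Qed.

(** An isomorphism preserves the second factors, and so induces [Q] on the first factors and [k] on
    the second. The central part of f (X, 0) may be nonzero but is invisible to brackets. *)
Lemma lie_isomorphic_congruence (R : realType) (m m' : nat)
    (J1 J2 : 'M[R]_m) (J1' J2' : 'M[R]_m')
    (mu : 'cV[R]_m -> 'cV[R]_m -> 'cV[R]_2)
    (mu' : 'cV[R]_m' -> 'cV[R]_m' -> 'cV[R]_2) :
  (forall X Y, mu X Y 0 0 = inner (J1 *m X) Y) ->
  (forall X Y, mu X Y 1 0 = inner (J2 *m X) Y) ->
  (forall a b : R, (a != 0) || (b != 0) -> a *: J1 + b *: J2 \in unitmx) ->
  (forall X Y, mu' X Y 0 0 = inner (J1' *m X) Y) ->
  (forall X Y, mu' X Y 1 0 = inner (J2' *m X) Y) ->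
  (forall a b : R, (a != 0) || (b != 0) -> a *: J1' + b *: J2' \in unitmx) ->
  m' = m -> lie_isomorphic (lie_of mu) (lie_of mu') ->
  exists (Q : 'M[R]_(m', m)) (Qi : 'M[R]_(m, m')) (k : 'M[R]_2),
    [/\ Q *m Qi = 1%:M, Qi *m Q = 1%:M,
        Q^T *m J1' *m Q = k 0 0 *: J1 + k 0 1 *: J2
      & Q^T *m J2' *m Q = k 1 0 *: J1 + k 1 1 *: J2].
Proof.
move=> mu0 mu1 ns mu0' mu1' ns' mm [f [[g fK gK] fbr]].
(* (0, c) brackets to zero with everything and [f] is onto. A nonzero first component would
   contradict nondegeneracy, tested on an arbitrary nonzero vector, here [const_mx 1]. *)
have fc c : (f (0, c)).1 = 0.
  apply/eqP/negPn/negP => w0.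
  suff : (const_mx 1 : 'cV[R]_2) = 0.
    by move/matrixP/(_ 0 0)/eqP; rewrite !mxE oner_eq0.
  apply: (mu_nondegenerate mu0' mu1' ns' w0) => Y.
  have := fbr (0, c) (g (Y, 0)); rewrite gK /lie_of /= (mu0l mu0 mu1).
  by rewrite linear0 => -[<-]; rewrite linear0l.
have [Q fQ0] : exists Q : 'M_(m', m), forall X, (f (X, 0)).1 = Q *m X.
  apply: linear_col_mx => c u v.
  have -> : (c *: u + v, 0) = c *: (u, 0) + (v, 0) :> 'cV[R]_m * 'cV[R]_2.
    by congr pair; rewrite /= scaler0 addr0.
  by rewrite linearP.
have fQ a b : (f (a, b)).1 = Q *m a.
  have -> : (a, b) = (a, 0) + (0, b) :> 'cV[R]_m * 'cV[R]_2.
    by congr pair; rewrite /= ?addr0 ?add0r.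
  by rewrite linearD /= fc addr0 fQ0.
have [k' fk] : exists k : 'M_2, forall c, (f (0, c)).2 = k *m c.
  apply: linear_col_mx => c u v.
  have -> : (0, c *: u + v) = c *: (0, u) + (0, v) :> 'cV[R]_m * 'cV[R]_2.
    by congr pair; rewrite /= scaler0 addr0.
  by rewrite linearP.
have muQ X Y : mu' (Q *m X) (Q *m Y) = k' *m mu X Y.
  have := fbr (X, 0) (Y, 0); rewrite /lie_of /= => /(congr1 snd) /=.
  by rewrite fk !fQ.
have cong a (J' : 'M_m') : (forall X Y, mu' X Y a 0 = inner (J' *m X) Y) ->
    Q^T *m J' *m Q = k' a 0 *: J1 + k' a 1 *: J2.
  move=> muJ; apply/matrixP => i j.
  have ent n (A : 'M[R]_n) (r l : 'I_n) :
      A r l = inner (A *m delta_mx l 0) (delta_mx r 0).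
    by rewrite /inner -!colE !mxE.
  rewrite ent [RHS]ent -!mulmxA inner_mulmx trmxK -muJ muQ mxE.
  rewrite big_ord_recl big_ord1 (_ : lift ord0 ord0 = 1); last exact: val_inj.
  by rewrite mu0 mu1 mulmxDl -!scalemxAl linearDl /= !linearZl_LR.
have Qinj (X : 'cV_m) : Q *m X = 0 -> X = 0.
  move=> QX; apply/eqP/negPn/negP => X0.
  suff : (const_mx 1 : 'cV[R]_2) = 0.
    by move/matrixP/(_ 0 0)/eqP; rewrite !mxE oner_eq0.
  apply: (mu_nondegenerate mu0 mu1 ns X0) => Y.
  suff -> : mu X Y = 0 by rewrite linear0l.
  have := fbr (X, 0) (Y, 0); rewrite /lie_of /= !fQ /= QX (mu0l mu0' mu1').
  have g0 : g (0, 0) = 0 by rewrite -[RHS]fK linear0.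
  by move/(congr1 g); rewrite fK g0 => -[].
have rkQ : \rank Q = m.
  rewrite -mxrank_tr; apply/eqP/inj_row_free => u /(congr1 trmx).
  rewrite trmx_mul trmxK trmx0 => /Qinj/(congr1 trmx).
  by rewrite trmxK trmx0.
have /row_fullP[L LQ] : row_full Q by rewrite /row_full rkQ.
have /row_freeP[L' QL] : row_free Q by rewrite /row_free rkQ mm.
have LL : L = L' by rewrite -[L]mulmx1 -QL mulmxA LQ mul1mx.
exists Q, L, k'; split=> //; first by rewrite LL.
  exact: cong.
exact: cong.
Qed.

(** * The Jordan chain at an isotropic point *)

Section JordanChain.
Variables (F : fieldType) (n : nat) (J1 J2 E : 'M[F]_n) (w : F).
Hypothesis w2 : w ^+ 2 = -1.
Hypothesis J22 : J2 *m J2 = - 1%:M.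
Hypothesis EJ1 : E *m J1 = J1 *m E.
Hypothesis EJ2 : E *m J2 = J2 *m E.
Let T := J2 *m J1.
Let U := sq_plus1 J1 J2.
Hypothesis EUU : E *m (U *m U) = 0.

(** As w^2 = -1, U = (T - w)(T + w). The columns are thus eigenvectors of T for [w] that also lie in
    the image of T - w, that is, heads of chains of length two. *)
Definition chain_head : 'M[F]_n := E *m (U *m (T + w%:M)).

Let P := J1 + w *: J2.

Let chain_factor : P *m (T + w%:M) = - (J2 *m U).
Proof.
have -> : P = J2 *m (- T + w%:M).
  by rewrite mulmxDr mulmxN {1}/P {1}(pencil_T J1 J22) mul_mx_scalar.
rewrite -mulmxA -[RHS]mulmxN; congr (_ *m _).
rewrite mulmxDl !mulmxDr mulNmx mulNmx scalar_mxC addrA subrK -scalar_mxM.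
by rewrite -expr2 w2 /U /sq_plus1 opprD raddfN.
Qed.

Let PE : P *m E = E *m P.
Proof. by rewrite /P mulmxDl mulmxDr -scalemxAl -scalemxAr EJ1 EJ2. Qed.

Let TU : U *m (T + w%:M) = (T + w%:M) *m U.
Proof.
rewrite mulmxDr mulmxDl scalar_mxC; congr (_ + _).
by rewrite /U /sq_plus1 -/T mulmxDl mulmxDr mulmx1 mul1mx !mulmxA.
Qed.

Lemma chain_head_ker : P *m chain_head = 0.
Proof.
rewrite /chain_head mulmxA PE -mulmxA TU (mulmxA P) chain_factor mulNmx mulmxN.
by rewrite -(mulmxA J2) (mulmxA E J2) EJ2 -(mulmxA J2) EUU mulmx0 oppr0.
Qed.

Lemma chain_next : exists W : 'M[F]_n, P *m W = J1 *m chain_head.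
Proof.
have -> : J1 *m chain_head = - (w *: (J2 *m chain_head)).
  by apply/eqP; rewrite -addr_eq0 scalemxAl -mulmxDl chain_head_ker.
exists (w *: (E *m ((T + w%:M) *m (T + w%:M)))).
rewrite -scalemxAr -scalerN; congr (_ *: _).
rewrite (mulmxA P) PE -(mulmxA E) (mulmxA P) chain_factor mulNmx mulmxN.
congr (- _).
by rewrite -(mulmxA J2) (mulmxA E J2) EJ2 -(mulmxA J2).
Qed.

End JordanChain.

(** For real matrices and w = i, the imaginary part of E U (T + i) is E U. *)
Lemma chain_head_neq0 (R : realType) m (J1 J2 E : 'M[R]_m) :
  let f := real_complex R in
  E *m sq_plus1 J1 J2 != 0 ->
  chain_head (map_mx f J1) (map_mx f J2) (map_mx f E) 'i%C != 0.
Proof.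
move=> f; apply: contraNneq => h; apply/eqP/matrixP => i j; rewrite [RHS]mxE.
have : ((E *m (sq_plus1 J1 J2 *m (J2 *m J1))) i j
    +i* (E *m sq_plus1 J1 J2) i j)%C = 0.
  have := congr1 (fun A : 'M_m => A i j) h.
  rewrite /chain_head /sq_plus1 -(map_mx1 f) -!map_mxM -map_mxD.
  rewrite mulmxDr -map_mxM mul_mx_scalar mulmxDr -scalemxAr -!map_mxM !mxE.
  move=> <-; apply/eqP; rewrite eq_complex /=.
  by rewrite !mul0r !mul1r subr0 ?addr0 ?add0r !eqxx.
by case.
Qed.

(** * Ranks of the complexified pencils *)

Section ComplexifiedFamily.
Variables (R : realType) (t : seq R).
Hypothesis ht : all (>= 1) t.
Let S := S_fam t.
Local Notation f := (real_complex R).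
Local Notation cmx := (map_mx (real_complex R)).
Implicit Types a b : R[i].

Lemma map_sq_plus1 n (A B : 'M[R]_n) : cmx (sq_plus1 A B) =
  sq_plus1 (cmx A) (cmx B).
Proof. by rewrite /sq_plus1 map_mxD map_mx1 !map_mxM. Qed.

Lemma cmx_J22 n (A : 'M[R]_n) : A *m A = - 1%:M -> cmx A *m cmx A = - 1%:M.
Proof. by move=> h; rewrite -map_mxM h map_mxN map_mx1. Qed.

Lemma cmx_comm n (A B : 'M[R]_n) : A *m B = B *m A ->
  cmx A *m cmx B = cmx B *m cmx A.
Proof. by move=> h; rewrite -!map_mxM h. Qed.

Lemma cmx_nilpotent n (E A B : 'M[R]_n) :
  E *m (sq_plus1 A B *m sq_plus1 A B) = 0 ->
  cmx E *m (sq_plus1 (cmx A) (cmx B) *m sq_plus1 (cmx A) (cmx B)) = 0.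
Proof. by move=> h; rewrite -map_sq_plus1 -!map_mxM h map_mx0. Qed.

Lemma cmx_sq n (E A : 'M[R]_n) s : E *m (A *m A) = - s ^+ 2 *: E ->
  cmx E *m (cmx A *m cmx A) = - f s ^+ 2 *: cmx E.
Proof.
by move=> h; rewrite -!map_mxM h map_mxZ rmorphN rmorphXn.
Qed.

Lemma cmx_anticomm n (E A B : 'M[R]_n) : E *m (A *m B + B *m A) = 0 ->
  cmx E *m (cmx A *m cmx B + cmx B *m cmx A) = 0.
Proof. by move=> h; rewrite -!map_mxM -map_mxD -map_mxM h map_mx0. Qed.

Lemma two_neq0C : 2%:R != 0 :> R[i].
Proof. by rewrite pnatr_eq0. Qed.

Lemma real_complex_neq0 (x : R) : x != 0 -> f x != 0.
Proof. by rewrite fmorph_eq0. Qed.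

Lemma block1_rank (s : R) a b : s != 0 -> a ^+ 2 + b ^+ 2 != 0 ->
  \rank (a *: cmx (Sblock ('i%C * s%:C%C)%R 1 1 0) +
         b *: cmx (Sblock ('i%C * s%:C%C)%R 1 0 1))%R =
  (if (f s ^+ 2 * a ^+ 2 + b ^+ 2 == 0)%R then 2 else 4)%N.
Proof.
move=> s0 ab0.
have J22 := cmx_J22 (Sblock1_J22 s).
have J11 : cmx (Sblock ('i%C * s%:C%C)%R 1 1 0) *m cmx (Sblock ('i%C * s%:C%C)%R 1 1 0)
    = - (f s ^+ 2)%:M.
  by rewrite -map_mxM Sblock1_J11 map_mxN map_scalar_mx rmorphXn.
have J12 : cmx (Sblock ('i%C * s%:C%C)%R 1 1 0) *m cmx (Sblock ('i%C * s%:C%C)%R 1 0 1)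
    + cmx (Sblock ('i%C * s%:C%C)%R 1 0 1) *m cmx (Sblock ('i%C * s%:C%C)%R 1 1 0) = 0.
  by rewrite -!map_mxM Sblock1_J12 map_mxN addNr.
move: (cmx _) (cmx _) J22 J11 J12 => J1 J2 J22 J11 J12.
have d4 : (\sum_(i < 1) 2 + \sum_(j < 1) 2 = 4)%N by rewrite !big_ord1.
have [c0|c0] := eqVneq; last first.
  exact: etrans (mxrank_unit (pencil_unit two_neq0C J22 J11 J12 c0)) d4.
have b0 : b != 0.
  apply: contraNneq ab0 => b0; move/eqP: c0; rewrite b0 expr0n !addr0.
  by rewrite mulf_eq0 expf_eq0 /= fmorph_eq0 (negPf s0).
have := etrans (pencil_rank_half two_neq0C J22 J11 J12 c0 b0) d4.
by case: (\rank _) => [|[|[|]]].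
Qed.

Lemma block2_rank a b : a ^+ 2 + b ^+ 2 != 0 ->
  \rank (a *: cmx (Sblock 'i%C 2 1 0) + b *: cmx (Sblock 'i%C 2 0 1))%R = 8%N.
Proof.
move=> ab0; have J22 := cmx_J22 (Sblock2_J22 R).
have UU : sq_plus1 (cmx (Sblock 'i%C 2 1 0)) (cmx (Sblock 'i%C 2 0 1)) *m
  sq_plus1 (cmx (Sblock 'i%C 2 1 0)) (cmx (Sblock 'i%C 2 0 1)) = 0.
  by rewrite -!map_sq_plus1 -map_mxM Sblock2_sq_plus1_nilpotent map_mx0.
apply: (etrans (mxrank_unit (pencil_nilpotent_unit J22 UU ab0))).
by rewrite !big_ord_recl !big_ord0.
Qed.

(** Off the isotropic points the block (i, 2) has full rank 8, and a block (i s, 1) drops from 4 to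
    2 exactly where s^2 a^2 + b^2 = 0. *)
Lemma fam_rank a b : a ^+ 2 + b ^+ 2 != 0 ->
  (\rank (a *: cmx (Spencil S 1 0) + b *: cmx (Spencil S 0 1))%R +
   2 * count (fun s => f s ^+ 2 * a ^+ 2 + b ^+ 2 == 0)%R t = 8 + 4 * size t)%N.
Proof.
move=> ab0; pose c (s : R) := f s ^+ 2 * a ^+ 2 + b ^+ 2 == 0.
pose h (p : R[i] * nat) : nat :=
  if p.2 == 2%N then 8%N else if c (complex.Im p.1) then 2%N else 4%N.
have -> : a *: cmx (Spencil S 1 0) + b *: cmx (Spencil S 0 1) =
  \mxdiag_l (a *: cmx (Sblock (tnth (in_tuple S) l).1 (tnth (in_tuple S) l).2 1 0)
   + b *: cmx (Sblock (tnth (in_tuple S) l).1 (tnth (in_tuple S) l).2 0 1)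
     : 'M_(bdim l)).
  by rewrite mxdiagD -!scale_mxdiag -!map_mxdiag.
rewrite rank_mxdiag.
have -> : (\sum_(l < size S) \rank
   (a *: cmx (Sblock (tnth (in_tuple S) l).1 (tnth (in_tuple S) l).2 1 0)
   + b *: cmx (Sblock (tnth (in_tuple S) l).1 (tnth (in_tuple S) l).2 0 1)
     : 'M_(bdim l))%R = \sum_(p <- S) h p)%N.
  rewrite [RHS](big_tnth _ _ S); apply: eq_bigr => l _.
  have gen p : p = ('i%C, 2%N) \/ (exists2 s, s \in t & p = (('i%C * s%:C%C)%R, 1%N)) ->
    \rank (a *: cmx (Sblock p.1 p.2 1 0) + b *: cmx (Sblock p.1 p.2 0 1))%R = h p.
    case=> [->|[s st ->]]; first exact: block2_rank.
    rewrite [LHS]block1_rank //; last first.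
      by rewrite gt_eqF // (lt_le_trans ltr01) // (allP ht).
    by rewrite /h /c /= mul0r add0r mul1r.
  apply: gen; have [[_ e]|[_ [s st e]]] := fam_index l; first by left.
  by right; exists s.
rewrite big_cons big_map /=.
have -> : h ('i%C, 2%N) = 8%N by [].
have hs (s : R) : h (('i%C * s%:C%C)%R, 1%N) = if c s then 2%N else 4%N.
  by rewrite /h /= mul0r add0r mul1r.
under eq_bigr do rewrite hs.
rewrite -addnA; congr (_ + _)%N; rewrite -/c.
elim: (t) => [|s u IH]; first by rewrite big_nil.
rewrite big_cons /= mulnS -IH mulnDr.
by case: (c s); lia.
Qed.

Lemma fam_projC1 l : l != ord0 -> exists2 s : R[i], s != 0 &
  cmx (fam_proj l) *m (cmx (Spencil S 1 0) *m cmx (Spencil S 1 0)) =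
    - s ^+ 2 *: cmx (fam_proj l) /\
  cmx (fam_proj l) *m (cmx (Spencil S 1 0) *m cmx (Spencil S 0 1) +
    cmx (Spencil S 0 1) *m cmx (Spencil S 1 0)) = 0.
Proof.
move=> /fam_proj1[s st [e1 e2]]; exists (f s).
  by rewrite real_complex_neq0 // gt_eqF // (lt_le_trans ltr01) // (allP ht).
by split; [exact: (cmx_sq e1)|exact: (cmx_anticomm e2)].
Qed.

End ComplexifiedFamily.

(** * Isomorphic members of the family have equal parameters *)

(** At a non-isotropic point every component of [X] dies: on [i0] because [X] is in the kernel, on
    the other blocks because they carry no chain of length two. *)
Lemma chain_isotropic (F : fieldType) (I : finType) (n p : nat)
    (A1 A2 : 'M[F]_n) (E : I -> 'M[F]_n) (i0 : I) (X Y : 'M[F]_(n, p))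
    (a b a' b' : F) :
  2%:R != 0 :> F -> A2 *m A2 = - 1%:M ->
  (forall l, E l *m A1 = A1 *m E l) -> (forall l, E l *m A2 = A2 *m E l) ->
  \sum_l E l = 1%:M ->
  E i0 *m (sq_plus1 A1 A2 *m sq_plus1 A1 A2) = 0 ->
  (forall l, l != i0 -> exists2 s, s != 0 &
     E l *m (A1 *m A1) = - s ^+ 2 *: E l /\
     E l *m (A1 *m A2 + A2 *m A1) = 0) ->
  X != 0 -> (a *: A1 + b *: A2) *m X = 0 ->
  (a *: A1 + b *: A2) *m Y = (a' *: A1 + b' *: A2) *m X ->
  a * b' - b * a' != 0 -> a ^+ 2 + b ^+ 2 = 0.
Proof.
move=> two0 A22 c1 c2 sE E0 El X0 PX PY ind; apply/eqP/negPn/negP => ab0.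
case/eqP: X0; rewrite -[LHS]mul1mx -sE mulmx_suml big1 // => l _.
have [->|/El[s s0 [e1 e2]]] := eqVneq l i0.
  by apply: (kernel_excluded A22 _ E0 ab0 PX); exact: mulmx_commM.
exact: (chain_excluded two0 A22 (c1 l) (c2 l) e1 e2 s0 PX PY ind).
Qed.

Lemma congruent_rank (F : fieldType) m n (Q : 'M[F]_(m, n)) (Qi : 'M[F]_(n, m))
    (P : 'M[F]_m) : Q *m Qi = 1%:M -> \rank (Q^T *m P *m Q) = \rank P.
Proof.
move=> QQ; apply/eqP; rewrite eqn_leq; apply/andP; split.
  by apply: leq_trans (mxrankM_maxl _ _) _; exact: mxrankM_maxr.
have eP : P = Qi^T *m (Q^T *m P *m Q) *m Qi.
  by rewrite -!mulmxA QQ mulmx1 mulmxA -trmx_mul QQ trmx1 mul1mx.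
rewrite [X in (X <= _)%N](congr1 mxrank eP).
by apply: leq_trans (mxrankM_maxl _ _) _; exact: mxrankM_maxr.
Qed.

Lemma lie_isomorphic_sym (R : realType) (V W : vectType R)
    (brV : V -> V -> V) (brW : W -> W -> W) :
  lie_isomorphic brV brW -> lie_isomorphic brW brV.
Proof.
case=> f [[g fK gK] fbr].
pose gL := GRing.isLinear.Build R W V *:%R g (can2_linear fK gK).
pose g' : {linear W -> V} := HB.pack g gL.
exists (linfun g'); split; first by exists f => x; rewrite lfunE /= ?fK ?gK.
by move=> x y; rewrite !lfunE /= -[LHS]fK [RHS](esym (fK _)) fbr !gK.
Qed.

Lemma sqr_imaginary (R : realType) : ('i%C : R[i]) ^+ 2 = -1.
Proof.
apply/eqP; rewrite expr2 eq_complex /=.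
by rewrite !(mul0r, mulr0, mul1r, addr0, sub0r, oppr0) !eqxx.
Qed.

Lemma cmx_congruence (R : realType) m n (Q : 'M[R]_(m, n)) (B : 'M[R]_m)
    (A1 A2 : 'M[R]_n) (a b : R) (f := real_complex R) :
  Q^T *m B *m Q = a *: A1 + b *: A2 ->
  (map_mx f Q)^T *m map_mx f B *m map_mx f Q =
    f a *: map_mx f A1 + f b *: map_mx f A2.
Proof.
move=> /(congr1 (map_mx f)); rewrite !map_mxM map_mxD !map_mxZ => <-.
by rewrite map_trmx.
Qed.

(* A congruence carries the Jordan chain of B at the isotropic point (1, i) to
   one of A, which by chain_isotropic sits at an isotropic point. *)
Lemma congruence_conformal (R : realType) (I : finType) (m n : nat)
    (A1 A2 : 'M[R[i]]_n) (B1 B2 : 'M[R[i]]_m) (E : I -> 'M[R[i]]_n) (i0 : I)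
    (Q : 'M[R[i]]_(m, n)) (Qi : 'M[R[i]]_(n, m)) p (X Y : 'M[R[i]]_(m, p))
    (k00 k01 k10 k11 : R) (f := real_complex R) :
  A2 *m A2 = - 1%:M ->
  (forall l, E l *m A1 = A1 *m E l) -> (forall l, E l *m A2 = A2 *m E l) ->
  \sum_l E l = 1%:M ->
  E i0 *m (sq_plus1 A1 A2 *m sq_plus1 A1 A2) = 0 ->
  (forall l, l != i0 -> exists2 s, s != 0 &
     E l *m (A1 *m A1) = - s ^+ 2 *: E l /\
     E l *m (A1 *m A2 + A2 *m A1) = 0) ->
  Q *m Qi = 1%:M ->
  Q^T *m B1 *m Q = f k00 *: A1 + f k01 *: A2 ->
  Q^T *m B2 *m Q = f k10 *: A1 + f k11 *: A2 ->
  X != 0 -> (B1 + 'i%C *: B2) *m X = 0 -> (B1 + 'i%C *: B2) *m Y = B1 *m X ->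
  k00 * k11 - k01 * k10 != 0 ->
  k00 ^+ 2 + k01 ^+ 2 = k10 ^+ 2 + k11 ^+ 2 /\ k00 * k10 + k01 * k11 = 0.
Proof.
move=> A22 EA1 EA2 sE E0 El CQ C1 C2 X0 kerX nextX det.
have rel : (f k00 + 'i%C * f k10) *: A1 + (f k01 + 'i%C * f k11) *: A2 =
    Q^T *m (B1 + 'i%C *: B2) *m Q.
  rewrite mulmxDr mulmxDl -scalemxAr -scalemxAl C1 C2 scalerDr !scalerA.
  by rewrite !scalerDl addrACA.
have : (f k00 + 'i%C * f k10) ^+ 2 + (f k01 + 'i%C * f k11) ^+ 2 = 0.
  apply: (@chain_isotropic _ _ _ _ _ _ E i0 (Qi *m X) (Qi *m Y) _ _
     (f k00) (f k01) (two_neq0C R) A22 EA1 EA2 sE E0 El).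
  - apply: contraNneq X0 => QX0; apply/eqP.
    by rewrite -[LHS]mul1mx -CQ -mulmxA QX0 mulmx0.
  - by rewrite rel -!mulmxA (mulmxA Q) CQ mul1mx kerX mulmx0.
  - by rewrite rel -C1 -!mulmxA !(mulmxA Q) CQ !mul1mx nextX.
  (* The image of (1, i) and the direction (k00, k01), image of (1, 0), have determinant - i det
     k. *)
  - rewrite (_ : _ - _ = 'i%C * f (- (k00 * k11 - k01 * k10))); last first.
      by rewrite /f rmorphN rmorphB !rmorphM; ring.
    rewrite mulf_neq0 //; last by rewrite real_complex_neq0 // oppr_eq0.
    by rewrite eq_complex /= oner_eq0 andbF.
move/eqP; rewrite !expr2 eq_complex /=.
rewrite !(mul0r, mul1r, mulr0, addr0, add0r, subr0, sub0r).
by move=> /andP[/eqP h1 /eqP h2]; split; lra.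
Qed.

Lemma fam_iso_conformal (R : realType) (s t : seq R)
    (Q : 'M[R]_(Sdim (S_fam t), Sdim (S_fam s)))
    (Qi : 'M[R]_(Sdim (S_fam s), Sdim (S_fam t))) (k00 k01 k10 k11 : R) :
  all (>= 1) s -> Q *m Qi = 1%:M ->
  Q^T *m Spencil (S_fam t) 1 0 *m Q =
    k00 *: Spencil (S_fam s) 1 0 + k01 *: Spencil (S_fam s) 0 1 ->
  Q^T *m Spencil (S_fam t) 0 1 *m Q =
    k10 *: Spencil (S_fam s) 1 0 + k11 *: Spencil (S_fam s) 0 1 ->
  k00 * k11 - k01 * k10 != 0 ->
  k00 ^+ 2 + k01 ^+ 2 = k10 ^+ 2 + k11 ^+ 2 /\ k00 * k10 + k01 * k11 = 0.
Proof.
move=> hs QQi c1 c2; have i2 := sqr_imaginary R.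
have jt := fam_J22 t.
have EJ1 := @fam_projM R t ord0 1 0; have EJ2 := @fam_projM R t ord0 0 1.
have EUU := fam_proj0_nilpotent t.
have X0 := chain_head_neq0 (fam_proj0_neq0 t).
have kerX := chain_head_ker i2 (cmx_J22 jt) (cmx_comm EJ1) (cmx_comm EJ2)
  (cmx_nilpotent EUU).
have [Y nextX] := chain_next i2 (cmx_J22 jt) (cmx_comm EJ1)
  (cmx_comm EJ2) (cmx_nilpotent EUU).
have C1 := cmx_congruence c1; have C2 := cmx_congruence c2.
have CQ : map_mx (real_complex R) Q *m map_mx (real_complex R) Qi = 1%:M.
  by rewrite -map_mxM QQi map_mx1.
have sE : \sum_l map_mx (real_complex R) (@fam_proj R s l) = 1%:M.
  by rewrite -map_mx_sum fam_proj_sum map_mx1.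
exact: (congruence_conformal (cmx_J22 (fam_J22 s))
  (fun l => cmx_comm (fam_projM l 1 0)) (fun l => cmx_comm (fam_projM l 0 1))
  sE (cmx_nilpotent (fam_proj0_nilpotent s)) (fam_projC1 hs) CQ C1 C2
  X0 kerX nextX).
Qed.

Lemma congruence_det (F : fieldType) m n (A1 A2 : 'M[F]_n) (B1 B2 : 'M[F]_m)
    (Q : 'M[F]_(m, n)) (Qi : 'M[F]_(n, m)) (k00 k01 k10 k11 : F) :
  (0 < m)%N ->
  (forall a b : F, (a != 0) || (b != 0) -> a *: B1 + b *: B2 \in unitmx) ->
  Q *m Qi = 1%:M -> Q^T *m B1 *m Q = k00 *: A1 + k01 *: A2 ->
  Q^T *m B2 *m Q = k10 *: A1 + k11 *: A2 ->
  k00 * k11 - k01 * k10 != 0.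
Proof.
move=> m0 ns QQi C1 C2; apply/eqP => det0.
have nz x y : (x != 0) || (y != 0) ->
    x * k00 + y * k10 = 0 -> x * k01 + y * k11 = 0 -> False.
  move=> /ns Pu e1 e2; have := congruent_rank (x *: B1 + y *: B2) QQi.
  rewrite (mxrank_unit Pu) mulmxDr mulmxDl -!scalemxAr -!scalemxAl C1 C2.
  rewrite !scalerDr !scalerA addrACA -!scalerDl e1 e2 !scale0r addr0 mxrank0.
  by move=> h; rewrite -h in m0.
(* (k11, - k01) and (k10, - k00) are rows annihilated by a singular [k]. At such a nonzero point the
   invertible pencil of [B1], [B2] would be congruent to 0. *)
have h1 : k11 = 0 /\ k01 = 0.
  have [->|k11n] := eqVneq k11 0; have [->|k01n] := eqVneq k01 0 => //;
    exfalso; apply: (@nz k11 (- k01)); rewrite ?oppr_eq0 ?k11n ?k01n ?orbT //;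
    first [by ring | by rewrite -[RHS]det0; ring].
case: h1 => h11 h01.
have [h00|k00n] := eqVneq k00 0; last first.
  apply: (@nz k10 (- k00)); rewrite ?oppr_eq0 ?k00n ?orbT //.
    by ring.
  by rewrite h11 h01; ring.
have [h10|k10n] := eqVneq k10 0; last first.
  apply: (@nz k10 (- k00)); rewrite ?k10n //.
    by ring.
  by rewrite h11 h01; ring.
apply: (@nz 1 0); first by rewrite oner_eq0.
  by rewrite h00 h10; ring.
by rewrite h01 h11; ring.
Qed.

Lemma congruence_rank (F : fieldType) m n (A1 A2 : 'M[F]_n) (B1 B2 : 'M[F]_m)
    (Q : 'M[F]_(m, n)) (Qi : 'M[F]_(n, m)) (k00 k01 k10 k11 x y : F) :
  Q *m Qi = 1%:M -> Q^T *m B1 *m Q = k00 *: A1 + k01 *: A2 ->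
  Q^T *m B2 *m Q = k10 *: A1 + k11 *: A2 ->
  \rank ((x * k00 + y * k10) *: A1 + (x * k01 + y * k11) *: A2)%R =
  \rank (x *: B1 + y *: B2)%R.
Proof.
move=> QQi C1 C2; rewrite -(congruent_rank (x *: B1 + y *: B2) QQi).
rewrite mulmxDr mulmxDl -!scalemxAr -!scalemxAl C1 C2.
by rewrite !scalerDr !scalerA addrACA -!scalerDl.
Qed.

(** The last two equations are the real and imaginary parts of v^2 a^2 + b^2 = 0 at the image of (1,
    i u), the latter up to the factor 2 u. For v = 1 conformality gives (u^2 - 1)(k00^2 + k01^2) =
    0, which is impossible. For v > 1 it makes [k] diagonal, where v^2 = u^2, or antidiagonal, where
    u v = 1 up to sign, against u, v > 1. *)
Lemma conformal_isotropic (R : realFieldType) (k00 k01 k10 k11 u v : R) :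
  k00 * k11 - k01 * k10 != 0 -> k00 ^+ 2 + k01 ^+ 2 = k10 ^+ 2 + k11 ^+ 2 ->
  k00 * k10 + k01 * k11 = 0 -> 1 < u -> 1 <= v ->
  v ^+ 2 * (k00 ^+ 2 - u ^+ 2 * k10 ^+ 2) + (k01 ^+ 2 - u ^+ 2 * k11 ^+ 2) = 0 ->
  v ^+ 2 * (k00 * k10) + k01 * k11 = 0 -> v = u.
Proof.
move=> det c1 c2 u1; rewrite le_eqVlt => /orP[/eqP <-|v1] e1 e2.
  have r0 : k00 ^+ 2 + k01 ^+ 2 = 0.
    have : (u ^+ 2 - 1) * (k00 ^+ 2 + k01 ^+ 2) = 0 by nra.
    move/eqP; rewrite mulf_eq0 => /orP[/eqP u2|/eqP//]; nra.
  move/eqP: r0; rewrite paddr_eq0 ?sqr_ge0 // !sqrf_eq0 => /andP[/eqP a0 /eqP b0].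
  by move: det; rewrite a0 b0 !mul0r subrr eqxx.
have e3 : k00 * k10 = 0.
  have : (v ^+ 2 - 1) * (k00 * k10) = 0 by nra.
  move/eqP; rewrite mulf_eq0 => /orP[/eqP v2|/eqP//]; nra.
have e4 : k01 * k11 = 0 by move: c2; rewrite e3 add0r.
move/eqP: e3; rewrite mulf_eq0 => /orP[/eqP a0|/eqP a0].
  have k01n : k01 != 0.
    by apply: contraNneq det => ->; rewrite a0 !mul0r subrr.
  have k11n : k11 = 0.
    by move/eqP: e4; rewrite mulf_eq0 (negPf k01n) => /eqP.
  have p : 0 < k01 ^+ 2 by rewrite exprn_even_gt0.
  have : (v ^+ 2 * u ^+ 2 - 1) * k01 ^+ 2 = 0.
    by move: c1 e1; rewrite a0 k11n !expr0n /= => c1 e1; nra.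
  move/eqP; rewrite mulf_eq0 (gt_eqF p) orbF subr_eq0 -exprMn => /eqP h.
  have : 1 < v * u by nra.
  move=> vu; have : 1 < (v * u) ^+ 2 by nra.
  by rewrite h ltxx.
have k11n : k11 != 0.
  by apply: contraNneq det => ->; rewrite a0 !mulr0 subrr.
have k01n : k01 = 0.
  by move/eqP: e4; rewrite mulf_eq0 (negPf k11n) orbF => /eqP.
have p : 0 < k11 ^+ 2 by rewrite exprn_even_gt0.
have : (v ^+ 2 - u ^+ 2) * k11 ^+ 2 = 0.
  by move: c1 e1; rewrite a0 k01n !expr0n /= => c1 e1; nra.
move/eqP; rewrite mulf_eq0 (gt_eqF p) orbF subr_eq0 eqf_sqr.
by case/orP=> /eqP // h; move: v1 u1; rewrite h => ? ?; lra.
Qed.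

Lemma quadric_complexE (R : realType) (k00 k01 k10 k11 tau x : R) :
  (x%:C%C ^+ 2 * (1 * k00%:C%C + 'i%C * tau%:C%C * k10%:C%C) ^+ 2 +
   (1 * k01%:C%C + 'i%C * tau%:C%C * k11%:C%C) ^+ 2 == 0) =
  (x ^+ 2 * (k00 ^+ 2 - tau ^+ 2 * k10 ^+ 2) +
     (k01 ^+ 2 - tau ^+ 2 * k11 ^+ 2) == 0) &&
  (2%:R * tau * (x ^+ 2 * (k00 * k10) + k01 * k11) == 0).
Proof.
by rewrite !expr2 eq_complex /=; congr (_ && _); congr (_ == _); ring.
Qed.

(** The rank at (1, i tau) for [t] equals the rank for [s] at the image of that point under [k].
    Each occurrence of [tau] in [t] lowers it by 2, and in [s] only entries equal to [tau] can lower
    it. The opposite inequality comes from the inverse isomorphism. *)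
Lemma fam_iso_count (R : realType) (s t : seq R) (tau : R) :
  all (>= 1) s -> all (>= 1) t -> size s = size t -> 1 < tau ->
  lie_isomorphic (lie_of (mu_of (S_fam s))) (lie_of (mu_of (S_fam t))) ->
  (count_mem tau t <= count_mem tau s)%N.
Proof.
move=> hs ht st tau1 iso.
have mm : Sdim (S_fam t) = Sdim (S_fam s) by rewrite !Sdim_fam st.
have m0 : (0 < Sdim (S_fam t))%N by rewrite Sdim_fam.
have [Q [Qi [k [QQi QiQ c1 c2]]]] := lie_isomorphic_congruence
  (@mu_of_row0 R s) (@mu_of_row1 R s) (fam_nonsing hs)
  (@mu_of_row0 R t) (@mu_of_row1 R t) (fam_nonsing ht) mm iso.
move: (k 0 0) (k 0 1) (k 1 0) (k 1 1) c1 c2 => k00 k01 k10 k11 c1 c2.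
have det := congruence_det m0 (fam_nonsing ht) QQi c1 c2.
have [cf1 cf2] := fam_iso_conformal hs QQi c1 c2 det.
have CQ : map_mx (real_complex R) Q *m map_mx (real_complex R) Qi = 1%:M.
  by rewrite -map_mxM QQi map_mx1.
have rk := congruence_rank 1 ('i%C * tau%:C%C) CQ (cmx_congruence c1)
  (cmx_congruence c2).
have := @fam_rank R s hs (1 * k00%:C%C + 'i%C * tau%:C%C * k10%:C%C)
  (1 * k01%:C%C + 'i%C * tau%:C%C * k11%:C%C).
have := @fam_rank R t ht 1 ('i%C * tau%:C%C).
rewrite rk; move: (\rank _) => r {rk c1 c2 Q Qi QQi QiQ CQ k iso}.
have tau2 : tau ^+ 2 != 1.
  by apply/eqP; move: tau1; clear => tau1 h; nra.
move=> h1 h2; have {}h1 : (r + 2 * count_mem tau t <= 8 + 4 * size t)%N.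
  rewrite -h1.
    rewrite leq_add2l leq_mul2l /=; apply: sub_count => x /eqP ->.
    by rewrite exprMn sqr_imaginary expr1n mulr1 mulN1r subrr.
  rewrite exprMn sqr_imaginary expr1n mulN1r subr_eq0 -rmorphXn /=.
  by apply: contraNneq tau2 => -[<-].
have {}h2 : (8 + 4 * size s <= r + 2 * count_mem tau s)%N.
  rewrite -h2.
    rewrite leq_add2l leq_mul2l /=.
    rewrite (@eq_in_count _ _ (fun x => (x == tau) && (x%:C%C ^+ 2 *
      (1 * k00%:C%C + 'i%C * tau%:C%C * k10%:C%C) ^+ 2 +
      (1 * k01%:C%C + 'i%C * tau%:C%C * k11%:C%C) ^+ 2 == 0))).
      by apply: sub_count => x /andP[].
    move=> x xs; rewrite andb_idl // quadric_complexE => /andP[/eqP e1].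
    rewrite !mulf_eq0 pnatr_eq0 /= (gt_eqF (lt_trans ltr01 tau1)) => /eqP e2.
    apply/eqP; exact: (conformal_isotropic det cf1 cf2 tau1 (allP hs _ xs) e1 e2).
  (* The image point must be non-isotropic for the rank formula: by conformality the real part of
     a^2 + b^2 is (1 - tau^2)(k00^2 + k01^2), which is nonzero. *)
  have := quadric_complexE k00 k01 k10 k11 tau 1.
  rewrite rmorph1 !expr1n !mul1r => ->.
  have -> : k00 ^+ 2 - tau ^+ 2 * k10 ^+ 2 + (k01 ^+ 2 - tau ^+ 2 * k11 ^+ 2) =
      (1 - tau ^+ 2) * (k00 ^+ 2 + k01 ^+ 2).
    transitivity ((k00 ^+ 2 + k01 ^+ 2) - tau ^+ 2 * (k10 ^+ 2 + k11 ^+ 2)).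
      by ring.
    by rewrite -cf1; ring.
  apply/nandP; left; rewrite mulf_eq0 subr_eq0 eq_sym (negPf tau2).
  rewrite paddr_eq0 ?sqr_ge0 // !sqrf_eq0; apply/negP => /andP[/eqP a0 /eqP b0].
  by move: det; rewrite a0 b0 !mul0r subrr eqxx.
by move: h1 h2; rewrite st; lia.
Qed.

(** The number of entries equal to 1 is the length minus the number of entries above 1, so equal
    lengths supply the one multiplicity that the ranks do not see. *)
Lemma sorted_eq_counts (R : realType) (s t : seq R) :
  path <=%R 1 s -> path <=%R 1 t -> size s = size t ->
  (forall x, 1 < x -> count_mem x s = count_mem x t) -> s = t.
Proof.
have ge1 (u : seq R) : path <=%R 1 u -> all (>= 1) u.
  by move=> pu; exact: order_path_min le_trans pu.
have ones (u : seq R) : all (>= 1) u ->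
    count_mem 1%R u = (size u - count (> 1)%R u)%N.
  elim: u => //= x u IH /andP[x1 /IH ->]; have := count_size (> 1) u.
  by move: x1; rewrite le_eqVlt => /orP[/eqP<-|x1];
     rewrite ?eqxx ?ltxx ?x1 ?(gt_eqF x1) /=; lia.
move=> ps pt st h; apply: (sorted_eq le_trans le_anti).
- exact: path_sorted ps.
- exact: path_sorted pt.
have gt1 : count (> 1) s = count (> 1) t.
  have /permP/(_ predT) : perm_eq (filter (> 1) s) (filter (> 1) t).
    apply/allP => x _ /=; rewrite !count_filter; apply/eqP.
    have [x1|x1] := boolP (1 < x).
      have e u : count (predI (pred1 x) (> 1)) u = count_mem x u.
        by apply: eq_count => y /=; case: eqVneq => // ->; rewrite x1.
      by rewrite !e h.
    have e u : count (predI (pred1 x) (> 1)) u = 0%N.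
      rewrite (@eq_count _ _ pred0) ?count_pred0 // => y /=.
      by case: eqVneq => // ->; rewrite (negPf x1).
    by rewrite !e.
  by rewrite !count_predT !size_filter.
apply/allP => x _ /=; apply/eqP; case: (ltgtP 1 x) => [/h //|x1|<-]; last first.
  by rewrite !ones ?ge1 // gt1 st.
have z u : all (>= 1) u -> count_mem x u = 0%N.
  move=> /allP u1; apply/count_memPn/negP => /u1 /=.
  by rewrite leNgt x1.
by rewrite !z ?ge1.
Qed.

Theorem mainTheorem8 (R : realType) (k : nat) (hk : (1 <= k)%N) :
  (forall t : k.-tuple R, path <=%R 1 t ->
     let mu := mu_of (S_fam t) in
     [/\ of_type 2 (8 + 4 * k) mu, two_step (lie_of mu),
         indecomposable (lie_of mu), nonsingular mu
       & ~ admits_nilsoliton (lie_of mu)])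
  /\
  (forall s t : k.-tuple R, path <=%R 1 s -> path <=%R 1 t -> s <> t ->
     ~ lie_isomorphic (lie_of (mu_of (S_fam s)))
                      (lie_of (mu_of (S_fam t)))).
Proof.
have ge1 (u : k.-tuple R) : path <=%R 1 u -> all (>= 1) u.
  by move=> pu; exact: order_path_min le_trans pu.
split=> [t pt|s t ps pt st iso].
  have := fam_structure (ge1 t pt); rewrite size_tuple; exact.
have sz : size s = size t by rewrite !size_tuple.
apply: st; apply: val_inj; apply: (sorted_eq_counts ps pt sz) => x x1.
apply/eqP; rewrite eqn_leq; apply/andP; split.
  exact: (fam_iso_count (ge1 t pt) (ge1 s ps) (esym sz) x1
    (lie_isomorphic_sym iso)).
exact: (fam_iso_count (ge1 s ps) (ge1 t pt) sz x1 iso).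
Qed.
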